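(* Let $G$ be a highly computable and connected infinite graph. Let $\mathrm{Sep}(G)$ be the collection of all finite sets of edges $E\subset E(G)$ such that $G\smallsetminus E$ has at least two infinite connected components, and let $\mathrm{Path}(G)$ be the set of finite words $v_0\dots v_n\in V(G)^\ast$ such that $v_0,\dots,v_n$ is a simple path in $G$ that can be extended to an infinite simple path. Then $\mathrm{Sep}(G)\geq_{T}\mathrm{Path}(G)$. If $G$ is a tree, then we have an equivalence $\mathrm{Sep}(G)\equiv_{T}\mathrm{Path}(G)$. The reductions are uniform on $G$.
   Context: Graphs are locally finite. A graph $G$ is highly computable when $V(G)$ is a decidable subset of $\mathbb{N}$, the adjacency relation is decidable, $G$ is locally finite and the vertex degree function is computable. $G\smallsetminus E$ is the subgraph induced by $E(G)\smallsetminus E$. A path is simple when every vertex is visited at most once. *)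

(* Defs.v *)
From Stdlib Require Import Arith List Cantor Relations.
Import ListNotations.

Notation pair_code x y := (Cantor.to_nat (x, y)).

Fixpoint list_code (l : list nat) : nat :=
  match l with
  | [] => 0
  | x :: l' => S (pair_code x (list_code l'))
  end.

Definition edges_code (E : list (nat * nat)) : nat :=
  list_code (map Cantor.to_nat E).

(** Unary partial functions on [nat]; several arguments are passed through the
    Cantor pairing. [Prec f g] sends [(a, 0)] to [f a] and [(a, n + 1)] to
    [g (a, (n, r))], with [r] the value at [(a, n)]; [Mu f] sends [a] to the
    least [n] such that [f (a, n) = 0], all earlier values being defined;
    [Oracle] is the characteristic function of the oracle. The identity is
    [Pair Fst Snd]. *)
Inductive code : Type :=
| Zero
| Succ
| Fst
| Snd
| Pair (f g : code)
| Comp (f g : code)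
| Prec (f g : code)
| Mu (f : code)
| Oracle.

Fixpoint prec_rel (F G : nat -> nat -> Prop) (a n : nat) : nat -> Prop :=
  match n with
  | 0 => F a
  | S n' => fun z =>
      exists r, prec_rel F G a n' r /\ G (pair_code a (pair_code n' r)) z
  end.

(** [eval A c x y]: with oracle [A], the program [c] halts on [x] with
    value [y]. *)
Fixpoint eval (A : nat -> Prop) (c : code) : nat -> nat -> Prop :=
  match c with
  | Zero => fun _ y => y = 0
  | Succ => fun x y => y = S x
  | Fst => fun x y => y = fst (Cantor.of_nat x)
  | Snd => fun x y => y = snd (Cantor.of_nat x)
  | Pair f g => fun x z =>
      exists y1 y2, eval A f x y1 /\ eval A g x y2 /\ z = pair_code y1 y2
  | Comp f g => fun x z => exists y, eval A g x y /\ eval A f y z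
  | Prec f g => fun x z =>
      prec_rel (eval A f) (eval A g)
        (fst (Cantor.of_nat x)) (snd (Cantor.of_nat x)) z
  | Mu f => fun x n =>
      eval A f (pair_code x n) 0 /\
      forall i, i < n -> exists k, eval A f (pair_code x i) (S k)
  | Oracle => fun x y => (A x /\ y = 1) \/ (~ A x /\ y = 0)
  end.

Fixpoint oracle_free (c : code) : Prop :=
  match c with
  | Zero | Succ | Fst | Snd => True
  | Pair f g | Comp f g | Prec f g => oracle_free f /\ oracle_free g
  | Mu f => oracle_free f
  | Oracle => False
  end.

Definition no_oracle : nat -> Prop := fun _ => False.

Fixpoint code_index (c : code) : nat :=
  match c with
  | Zero => pair_code 0 0
  | Succ => pair_code 1 0
  | Fst => pair_code 2 0
  | Snd => pair_code 3 0
  | Pair f g => pair_code 4 (pair_code (code_index f) (code_index g))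
  | Comp f g => pair_code 5 (pair_code (code_index f) (code_index g))
  | Prec f g => pair_code 6 (pair_code (code_index f) (code_index g))
  | Mu f => pair_code 7 (code_index f)
  | Oracle => pair_code 8 0
  end.

Definition reduction (c : code) (A B : nat -> Prop) : Prop :=
  forall n, (A n -> eval B c n 1) /\ (~ A n -> eval B c n 0).

Definition turing_le (A B : nat -> Prop) : Prop :=
  exists c, reduction c A B.

Definition turing_equiv (A B : nat -> Prop) : Prop :=
  turing_le A B /\ turing_le B A.

Definition decides (c : code) (A : nat -> Prop) : Prop :=
  oracle_free c /\ reduction c A no_oracle.

Record graph : Type := Graph {
  vert : nat -> Prop;
  adj : nat -> nat -> Prop;
  adj_vert : forall u v, adj u v -> vert u;
  adj_sym : forall u v, adj u v -> adj v u;
  adj_irrefl : forall u, ~ adj u u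
}.

Definition infinite_set (A : nat -> Prop) : Prop :=
  ~ exists l : list nat, forall x, A x -> In x l.

Definition infinite_graph (G : graph) : Prop := infinite_set (vert G).

Definition locally_finite (G : graph) : Prop :=
  forall v, vert G v -> exists l, forall u, adj G v u -> In u l.

Definition degree (G : graph) (v d : nat) : Prop :=
  exists l, NoDup l /\ (forall u, In u l <-> adj G v u) /\ length l = d.

Definition joined (G : graph) : nat -> nat -> Prop :=
  clos_refl_trans nat (adj G).

Definition connected (G : graph) : Prop :=
  forall u v, vert G u -> vert G v -> joined G u v.

Definition component (G : graph) (C : nat -> Prop) : Prop :=
  exists v, vert G v /\ forall u, C u <-> joined G v u.

Definition is_path (G : graph) (w : list nat) : Prop :=
  w <> [] /\ Forall (vert G) w /\
  forall i, S i < length w -> adj G (nth i w 0) (nth (S i) w 0).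

Definition simple_path (G : graph) (w : list nat) : Prop :=
  is_path G w /\ NoDup w.

Definition infinite_simple_path (G : graph) (p : nat -> nat) : Prop :=
  (forall i, adj G (p i) (p (S i))) /\ (forall i j, p i = p j -> i = j).

Definition cycle (G : graph) (w : list nat) : Prop :=
  simple_path G w /\ 3 <= length w /\ adj G (last w 0) (hd 0 w).

Definition tree (G : graph) : Prop :=
  connected G /\ forall w, ~ cycle G w.

(** A finite set of edges is a list of pairs, in which [(u, v)] and [(v, u)]
    stand for the same undirected edge. *)
Definition edge_mem (u v : nat) (E : list (nat * nat)) : Prop :=
  In (u, v) E \/ In (v, u) E.

Definition remaining (G : graph) (E : list (nat * nat)) (u v : nat) : Prop :=
  adj G u v /\ ~ edge_mem u v E.

Definition remaining_vert (G : graph) (E : list (nat * nat)) (v : nat) : Prop :=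
  exists u, remaining G E v u.

Lemma remaining_adj_vert G E u v : remaining G E u v -> remaining_vert G E u.
Proof. intros H; exists v; exact H. Qed.

Lemma remaining_sym G E u v : remaining G E u v -> remaining G E v u.
Proof.
intros [H1 H2]; split; [now apply adj_sym|].
intros [H|H]; apply H2; [now right|now left].
Qed.

Lemma remaining_irrefl G E u : ~ remaining G E u u.
Proof. intros [H _]; exact (adj_irrefl G u H). Qed.

(** The subgraph induced by the remaining edges: a vertex all of whose edges
    are deleted disappears. *)
Definition delete_edges (G : graph) (E : list (nat * nat)) : graph :=
  Graph (remaining_vert G E) (remaining G E) (remaining_adj_vert G E)
    (remaining_sym G E) (remaining_irrefl G E).

Definition two_infinite_components (G : graph) : Prop :=
  exists C D,
    component G C /\ component G D /\
    infinite_set C /\ infinite_set D /\ ~ (forall v, C v <-> D v).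

Definition separates (G : graph) (E : list (nat * nat)) : Prop :=
  Forall (fun e => adj G (fst e) (snd e)) E /\
  two_infinite_components (delete_edges G E).

Definition extendable (G : graph) (w : list nat) : Prop :=
  simple_path G w /\
  exists p, infinite_simple_path G p /\
            forall i, i < length w -> nth i w 0 = p i.

Definition Sep (G : graph) : nat -> Prop :=
  fun n => exists E, n = edges_code E /\ separates G E.

Definition Path (G : graph) : nat -> Prop :=
  fun n => exists w, n = list_code w /\ extendable G w.

Record description : Type := Description {
  vert_code : code;
  adj_code : code;
  deg_code : code
}.

Definition adj_set (G : graph) : nat -> Prop :=
  fun n => exists u v, n = pair_code u v /\ adj G u v.

Definition describes (D : description) (G : graph) : Prop :=
  locally_finite G /\
  decides (vert_code D) (vert G) /\
  decides (adj_code D) (adj_set G) /\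
  oracle_free (deg_code D) /\
  (forall v, vert G v ->
     exists d, degree G v d /\ eval no_oracle (deg_code D) v d).

Definition highly_computable (G : graph) : Prop :=
  exists D, describes D G.

Definition description_index (D : description) : nat :=
  pair_code (code_index (vert_code D))
    (pair_code (code_index (adj_code D)) (code_index (deg_code D))).

(** Uniformity over the graphs in [K]: one computable function sends an index
    of any description of [G] to an index of a reduction of [A G] to [B G]. *)
Definition uniform_turing_le (K : graph -> Prop) (A B : graph -> nat -> Prop)
    : Prop :=
  exists f, oracle_free f /\
    forall G D, K G -> describes D G ->
      exists r,
        eval no_oracle f (description_index D) (code_index r) /\
        reduction r (A G) (B G).

(* Main.v *)
(** A set is reducible to [B] as soon as it and its complement are enumerable
    relative to [B], so each reduction amounts to four kinds of finite
    certificates.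

    By Koenig's lemma a simple path [w] ending in [u] is extendable iff the
    component [C] of [u], once the other vertices of [w] are removed, is
    infinite. That [C] is finite is witnessed by a finite list closed under
    neighbours. That [C] is infinite is witnessed either by a finite list
    containing the complement of [C], or, when this complement is infinite, by a
    separating set [F] of edges leaving exactly two components, one of which
    contains [w] while the other meets [C]: the latter component avoids [w],
    hence lies in [C], and it is infinite because [F] separates.

    In a tree, a finite set [E] of edges separates iff there are extendable
    edges [(x, y)] and [(x', y')] such that [E] lies on the side of [x],
    respectively [x'], together with an edge of [E] between [x] and [x']. It
    does not separate iff all endpoints of [E] outside one component have a
    finite component.

    The programs are built by combinators out of those of the description, so
    that an index of the result is computable from one of the description. *)

From Stdlib Require Import Arith List Cantor Relations Lia Classical IndefiniteDescription.
Require Import Defs.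
Import ListNotations.

Arguments Cantor.to_nat : simpl never.
Arguments Cantor.of_nat : simpl never.

(** * Programs *)

(** Quantifying over all oracles lets one program serve in reductions to any set and, with the empty
    oracle, in the computation of indices. *)
Definition computable (f : nat -> nat) : Prop :=
  exists c, oracle_free c /\ forall A n, eval A c n (f n).

Lemma computable_ext f g :
  (forall n, f n = g n) -> computable f -> computable g.
Proof.
intros H [c [Hc Ec]]; exists c; split; [exact Hc|].
now intros A n; rewrite <- H.
Qed.

Definition identity_code : code := Pair Fst Snd.

Lemma eval_identity A n : eval A identity_code n n.
Proof.
exists (fst (Cantor.of_nat n)), (snd (Cantor.of_nat n)).
split; [reflexivity|]; split; [reflexivity|].
now rewrite <- surjective_pairing, Cantor.cancel_to_of.
Qed.

Lemma computable_id : computable (fun n => n).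
Proof.
exists identity_code; split; [now split|]; intros A n; apply eval_identity.
Qed.

Lemma computable_comp f g :
  computable f -> computable g -> computable (fun n => f (g n)).
Proof.
intros [c [Hc Ec]] [d [Hd Ed]]; exists (Comp c d); split; [now split|].
intros A n; exists (g n); now split.
Qed.

Lemma computable_succ : computable S.
Proof. exists Succ; now split. Qed.

Lemma computable_const k : computable (fun _ => k).
Proof.
induction k as [|k IH]; [exists Zero; now split|].
exact (computable_comp _ _ computable_succ IH).
Qed.

Lemma computable_pair f g :
  computable f -> computable g -> computable (fun n => pair_code (f n) (g n)).
Proof.
intros [c [Hc Ec]] [d [Hd Ed]]; exists (Pair c d); split; [now split|].
intros A n; exists (f n), (g n); now repeat split.
Qed.

Lemma computable_fst : computable (fun n => fst (Cantor.of_nat n)).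
Proof. exists Fst; now split. Qed.

Lemma computable_snd : computable (fun n => snd (Cantor.of_nat n)).
Proof. exists Snd; now split. Qed.

Lemma computable_prec f g :
  computable f -> computable g ->
  computable (fun n =>
    nat_rect (fun _ => nat) (f (fst (Cantor.of_nat n)))
      (fun i r => g (pair_code (fst (Cantor.of_nat n)) (pair_code i r)))
      (snd (Cantor.of_nat n))).
Proof.
intros [c [Hc Ec]] [d [Hd Ed]]; exists (Prec c d); split; [now split|].
intros A n; simpl.
generalize (snd (Cantor.of_nat n)); intros m.
induction m as [|m IH]; simpl; [apply Ec|].
eexists; split; [exact IH|]; apply Ed.
Qed.

(** Primitive recursion with parameter and depth supplied separately, which removes the packing into
    one argument. *)
Lemma computable_rec f g a b :
  computable f -> computable g -> computable a -> computable b ->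
  computable (fun n =>
    nat_rect (fun _ => nat) (f (a n))
      (fun i r => g (pair_code (a n) (pair_code i r))) (b n)).
Proof.
intros Hf Hg Ha Hb.
eapply computable_ext;
  [|exact (computable_comp _ _ (computable_prec f g Hf Hg)
             (computable_pair a b Ha Hb))].
intros n; cbv beta; now rewrite !Cantor.cancel_of_to.
Qed.

Lemma computable_pred : computable pred.
Proof.
eapply computable_ext;
  [|apply (computable_rec (fun _ => 0)
             (* The step returns the counter, which is [i] when the value at [S i] is formed. *)
             (fun n => fst (Cantor.of_nat (snd (Cantor.of_nat n))))
             (fun n => n) (fun n => n))].
- intros [|n]; simpl; [reflexivity|].
  now rewrite !Cantor.cancel_of_to; simpl; rewrite Cantor.cancel_of_to.
- apply computable_const.
- exact (computable_comp _ _ computable_fst computable_snd).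
- apply computable_id.
- apply computable_id.
Qed.

Lemma computable_sub f g :
  computable f -> computable g -> computable (fun n => f n - g n).
Proof.
intros Hf Hg.
eapply computable_ext;
  [|apply (computable_rec (fun n => n)
             (fun n => pred (snd (Cantor.of_nat (snd (Cantor.of_nat n)))))
             f g)]; trivial.
- intros n; cbv beta; induction (g n) as [|m IH]; cbn [nat_rect]; [lia|].
  rewrite !Cantor.cancel_of_to; simpl; rewrite Cantor.cancel_of_to; simpl.
  rewrite IH; lia.
- apply computable_id.
- apply (computable_comp pred); [apply computable_pred|].
  exact (computable_comp _ _ computable_snd computable_snd).
Qed.

Lemma computable_add f g :
  computable f -> computable g -> computable (fun n => f n + g n).
Proof.
intros Hf Hg.
eapply computable_ext;
  [|apply (computable_rec (fun n => n)
             (fun n => S (snd (Cantor.of_nat (snd (Cantor.of_nat n)))))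
             f g)]; trivial.
- intros n; cbv beta; induction (g n) as [|m IH]; cbn [nat_rect]; [lia|].
  rewrite !Cantor.cancel_of_to; simpl; rewrite Cantor.cancel_of_to; simpl.
  rewrite IH; lia.
- apply computable_id.
- apply (computable_comp S); [apply computable_succ|].
  exact (computable_comp _ _ computable_snd computable_snd).
Qed.

Lemma prec_rel_iff (F F' H H' : nat -> nat -> Prop) a n z :
  (forall x y, F x y <-> F' x y) -> (forall x y, H x y <-> H' x y) ->
  prec_rel F H a n z <-> prec_rel F' H' a n z.
Proof.
intros HF HH; revert z; induction n as [|n IH]; intros z; simpl; [apply HF|].
split; intros [r [H1 H2]]; exists r; split;
  solve [now apply IH | now apply HH].
Qed.

(** The programs of a description are specified for the empty oracle but run inside reductions; this
    transfers them to any oracle. *)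
Lemma eval_oracle_free A B c :
  oracle_free c -> forall x y, eval A c x y <-> eval B c x y.
Proof.
induction c as [| | | |f IHf g IHg|f IHf g IHg|f IHf g IHg|f IHf|];
  simpl; intros Hc x y; try reflexivity; try easy.
- destruct Hc as [Hf Hg].
  split; intros (y1 & y2 & H1 & H2 & H3); exists y1, y2;
    (split; [now apply IHf|split; [now apply IHg|exact H3]]).
- destruct Hc as [Hf Hg].
  split; intros (y1 & H1 & H2); exists y1;
    (split; [now apply IHg|now apply IHf]).
- destruct Hc as [Hf Hg]; apply prec_rel_iff; auto.
- split; intros [H1 H2]; split; try (now apply IHf);
    intros i Hi; destruct (H2 i Hi) as [k Hk]; exists k; now apply IHf.
Qed.

(** * Programs depending on the description of a graph *)

Definition index_computable (i : description -> nat) : Prop :=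
  exists f, oracle_free f /\
    forall D, eval no_oracle f (description_index D) (i D).

(** This is the uniformity demanded by [uniform_turing_le]: the program may depend on the
    description, but only through a computable transformation of indices. *)
Definition indexable (T : description -> code) : Prop :=
  index_computable (fun D => code_index (T D)).

Lemma index_const k : index_computable (fun _ => k).
Proof.
destruct (computable_const k) as [c [Hc Ec]].
exists c; split; [exact Hc|]; intros D; apply Ec.
Qed.

Lemma index_pair i j :
  index_computable i -> index_computable j ->
  index_computable (fun D => pair_code (i D) (j D)).
Proof.
intros [f [Hf Ef]] [g [Hg Eg]]; exists (Pair f g); split; [now split|].
intros D; exists (i D), (j D); now repeat split.
Qed.

Lemma index_comp f i :
  computable f -> index_computable i -> index_computable (fun D => f (i D)).
Proof.
intros [c [Hc Ec]] [g [Hg Eg]]; exists (Comp c g); split; [now split|].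
intros D; exists (i D); split; [apply Eg|apply Ec].
Qed.

Lemma index_id : index_computable description_index.
Proof.
destruct computable_id as [c [Hc Ec]].
exists c; split; [exact Hc|]; intros D; apply Ec.
Qed.

Lemma indexable_const c : indexable (fun _ => c).
Proof. exact (index_const (code_index c)). Qed.

Lemma indexable_pair T U :
  indexable T -> indexable U -> indexable (fun D => Pair (T D) (U D)).
Proof.
intros HT HU.
exact (index_pair _ _ (index_const 4) (index_pair _ _ HT HU)).
Qed.

Lemma indexable_comp T U :
  indexable T -> indexable U -> indexable (fun D => Comp (T D) (U D)).
Proof.
intros HT HU.
exact (index_pair _ _ (index_const 5) (index_pair _ _ HT HU)).
Qed.

Lemma indexable_prec T U :
  indexable T -> indexable U -> indexable (fun D => Prec (T D) (U D)).
Proof.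
intros HT HU.
exact (index_pair _ _ (index_const 6) (index_pair _ _ HT HU)).
Qed.

Lemma indexable_mu T : indexable T -> indexable (fun D => Mu (T D)).
Proof. intros HT; exact (index_pair _ _ (index_const 7) HT). Qed.

Lemma indexable_vert : indexable vert_code.
Proof.
destruct (index_comp _ _ computable_fst index_id) as [f [Hf Ef]].
exists f; split; [exact Hf|]; intros D; generalize (Ef D).
now unfold description_index; rewrite Cantor.cancel_of_to.
Qed.

Lemma indexable_adj : indexable adj_code.
Proof.
destruct (index_comp _ _ computable_fst (index_comp _ _ computable_snd index_id))
  as [f [Hf Ef]].
exists f; split; [exact Hf|]; intros D; generalize (Ef D).
now unfold description_index; rewrite Cantor.cancel_of_to; simpl;
  rewrite Cantor.cancel_of_to.
Qed.

Lemma indexable_deg : indexable deg_code.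
Proof.
destruct (index_comp _ _ computable_snd (index_comp _ _ computable_snd index_id))
  as [f [Hf Ef]].
exists f; split; [exact Hf|]; intros D; generalize (Ef D).
now unfold description_index; rewrite Cantor.cancel_of_to; simpl;
  rewrite Cantor.cancel_of_to.
Qed.

(** * Boolean operations on reductions *)

(** [d] is only run when [c] returns [1], so it may diverge elsewhere. *)
Definition and_code (c d : code) : code :=
  Comp (Prec Zero (Comp d Fst)) (Pair identity_code c).

Definition not_code (c : code) : code :=
  Comp (Prec (Comp Succ Zero) Zero) (Pair identity_code c).

Lemma eval_not A c n k :
  eval A c n k -> eval A (not_code c) n (match k with 0 => 1 | _ => 0 end).
Proof.
intros Hk; exists (pair_code n k); split.
- exists n, k; split; [apply eval_identity|now split].
- simpl; rewrite Cantor.cancel_of_to; simpl.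
  destruct k as [|k]; simpl; [now exists 0|].
  (* The step ignores the previous value, but [prec_rel] still requires one to exist. *)
  assert (H : exists r, prec_rel
    (fun _ z => exists y, y = 0 /\ z = S y) (fun _ y => y = 0) n k r).
  { clear Hk; induction k as [|k IH]; [now exists 1, 0|].
    destruct IH as [r IH]; now exists 0, r. }
  destruct H as [r Hr]; now exists r.
Qed.

Lemma eval_and_0 A c d n : eval A c n 0 -> eval A (and_code c d) n 0.
Proof.
intros Hc; exists (pair_code n 0); split.
- exists n, 0; split; [apply eval_identity|now split].
- now simpl; rewrite Cantor.cancel_of_to.
Qed.

Lemma eval_and_1 A c d n k :
  eval A c n 1 -> eval A d n k -> eval A (and_code c d) n k.
Proof.
intros Hc Hd; exists (pair_code n 1); split.
- exists n, 1; split; [apply eval_identity|now split].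
- simpl; rewrite Cantor.cancel_of_to; simpl.
  exists 0; split; [reflexivity|]; exists n; split; [|exact Hd].
  now rewrite Cantor.cancel_of_to.
Qed.

(** Correctness of [d] is asked only where [P] holds, because the degree program of a description is
    specified only at vertices. *)
Lemma reduction_and c d (P Q A : nat -> Prop) :
  reduction c P A ->
  (forall n, P n -> (Q n -> eval A d n 1) /\ (~ Q n -> eval A d n 0)) ->
  reduction (and_code c d) (fun n => P n /\ Q n) A.
Proof.
intros Hc Hd n; split.
- intros [HP HQ]; apply eval_and_1; [now apply Hc|now apply Hd].
- intros HN; destruct (classic (P n)) as [HP|HP].
  + apply eval_and_1; [now apply Hc|].
    apply Hd; [exact HP|]; intros HQ; now apply HN.
  + now apply eval_and_0, Hc.
Qed.

Lemma reduction_not c (P A : nat -> Prop) :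
  reduction c P A -> reduction (not_code c) (fun n => ~ P n) A.
Proof.
intros Hc n; split; intros H.
- now apply (eval_not A c n 0), Hc.
- apply (eval_not A c n 1), Hc; now apply NNPP.
Qed.

Lemma reduction_comp c d f (P A : nat -> Prop) :
  reduction c P A -> (forall n, eval A d n (f n)) ->
  reduction (Comp c d) (fun n => P (f n)) A.
Proof.
intros Hc Hd n; split; intros H; exists (f n); (split; [apply Hd|now apply Hc]).
Qed.

(** Bounded quantification by recursion: the accumulated value is the conjunction so far, and once
    it is 0 the test [c] is no longer run. *)
Definition ball_code (c : code) : code :=
  Prec (Comp Succ Zero)
    (and_code (Comp Snd Snd) (Comp c (Pair Fst (Comp Fst Snd)))).

Lemma reduction_ball c (P A : nat -> Prop) :
  reduction c P A ->
  reduction (ball_code c)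
    (fun n => forall i, i < snd (Cantor.of_nat n) ->
       P (pair_code (fst (Cantor.of_nat n)) i)) A.
Proof.
intros Hc n; unfold ball_code.
set (g := and_code _ _).
assert (E2 : forall a i r, eval A (Comp Snd Snd) (pair_code a (pair_code i r)) r).
{ intros a i r; simpl; eexists; split; [reflexivity|].
  now rewrite !Cantor.cancel_of_to; simpl; rewrite Cantor.cancel_of_to. }
assert (E1 : forall a i r, eval A (Pair Fst (Comp Fst Snd))
               (pair_code a (pair_code i r)) (pair_code a i)).
{ intros a i r; simpl; exists a, i; rewrite !Cantor.cancel_of_to; simpl.
  split; [reflexivity|]; split; [|reflexivity].
  eexists; split; [reflexivity|]; now rewrite Cantor.cancel_of_to. }
assert (G0 : forall a i, eval A g (pair_code a (pair_code i 0)) 0)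
  by (intros a i; apply eval_and_0, E2).
assert (G1 : forall a i k, eval A c (pair_code a i) k ->
               eval A g (pair_code a (pair_code i 1)) k).
{ intros a i k Hk; apply eval_and_1; [apply E2|].
  exists (pair_code a i); split; [apply E1|exact Hk]. }
clearbody g; simpl.
generalize (fst (Cantor.of_nat n)) (snd (Cantor.of_nat n)).
intros a m; induction m as [|m [IH1 IH0]]; simpl.
- split; [intros _; now exists 0|].
  intros H; exfalso; apply H; intros i Hi; lia.
- split; intros H.
  + exists 1; split; [apply IH1; intros i Hi; apply H; lia|].
    apply G1, Hc, H; lia.
  (* Either the failure is at the last index [m], or the accumulator is already 0. *)
  + destruct (classic (forall i, i < m -> P (pair_code a i))) as [H'|H'].
    * exists 1; split; [now apply IH1|].
      apply G1, Hc; intros Hm.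
      apply H; intros i Hi; destruct (Nat.eq_dec i m) as [->|Hne]; [exact Hm|].
      apply H'; lia.
    * exists 0; split; [now apply IH0|apply G0].
Qed.

(** * Coded types *)

(** A bijection with the numbers rather than a mere injection: every number is a code, so predicates
    on [X] become predicates on [nat] with no invalid codes to treat. *)
Class coded (X : Type) := Coded {
  enc : X -> nat;
  den : nat -> X;
  den_enc : forall x, den (enc x) = x;
  enc_den : forall n, enc (den n) = n
}.

Lemma enc_inj {X} `{coded X} (x y : X) : enc x = enc y -> x = y.
Proof. intros E; rewrite <- (den_enc x), E; apply den_enc. Qed.

#[export] Instance coded_nat : coded nat.
Proof. now exists (fun n => n) (fun n => n). Defined.

#[export] Instance coded_prod X Y `{coded X} `{coded Y} : coded (X * Y).
Proof.
exists (fun p => pair_code (enc (fst p)) (enc (snd p)))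
       (fun n => (den (fst (Cantor.of_nat n)), den (snd (Cantor.of_nat n)))).
- intros [x y]; rewrite Cantor.cancel_of_to; simpl; now rewrite !den_enc.
- intros n; simpl; rewrite !enc_den, <- surjective_pairing.
  apply Cantor.cancel_to_of.
Defined.

(** The code of a tail is smaller than that of the list, so [n] itself is enough fuel for decoding
    [n]. *)
Fixpoint decode_list (fuel n : nat) : list nat :=
  match fuel, n with
  | S k, S m => fst (Cantor.of_nat m) :: decode_list k (snd (Cantor.of_nat m))
  | _, _ => []
  end.

Lemma list_code_decode k n : n <= k -> list_code (decode_list k n) = n.
Proof.
revert n; induction k as [|k IH]; intros [|n] Hn; simpl; try lia.
rewrite IH.
- now rewrite <- surjective_pairing, Cantor.cancel_to_of.
- generalize (Cantor.to_nat_non_decreasing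
    (fst (Cantor.of_nat n)) (snd (Cantor.of_nat n))).
  rewrite <- surjective_pairing, Cantor.cancel_to_of; lia.
Qed.

Lemma list_code_inj l l' : list_code l = list_code l' -> l = l'.
Proof.
revert l'; induction l as [|x l IH]; intros [|y l']; simpl; try easy.
intros E; injection E as E.
apply (f_equal Cantor.of_nat) in E; rewrite !Cantor.cancel_of_to in E.
injection E as -> E; now rewrite (IH l' E).
Qed.

#[export] Instance coded_list X `{coded X} : coded (list X).
Proof.
exists (fun l => list_code (map enc l)) (fun n => map den (decode_list n n)).
- intros l; set (n := list_code _).
  (* Decoding is a right inverse of the injective [list_code], hence also a left inverse. *)
  replace (decode_list n n) with (map enc l).
  + rewrite map_map; erewrite map_ext; [apply map_id|apply den_enc].
  + apply list_code_inj; now rewrite list_code_decode.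
- intros n; rewrite map_map; erewrite map_ext; [|apply enc_den].
  rewrite map_id; now apply list_code_decode.
Defined.

(** * Computable maps between coded types *)

Definition comp {X Y} `{coded X} `{coded Y} (f : X -> Y) : Prop :=
  computable (fun n => enc (f (den n))).

Lemma comp_id {X} `{coded X} : comp (fun x : X => x).
Proof.
apply (computable_ext (fun n => n)); [|apply computable_id].
intros n; now rewrite enc_den.
Qed.

Lemma comp_const {X Y} `{coded X} `{coded Y} (y : Y) : comp (fun _ : X => y).
Proof. exact (computable_const (enc y)). Qed.

Lemma comp_comp {X Y Z} `{coded X} `{coded Y} `{coded Z}
    (f : Y -> Z) (g : X -> Y) : comp f -> comp g -> comp (fun x => f (g x)).
Proof.
intros Hf Hg; generalize (computable_comp _ _ Hf Hg); apply computable_ext.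
intros n; now rewrite den_enc.
Qed.

Lemma comp_pair {X Y Z} `{coded X} `{coded Y} `{coded Z}
    (f : X -> Y) (g : X -> Z) : comp f -> comp g -> comp (fun x => (f x, g x)).
Proof. exact (computable_pair _ _). Qed.

Lemma comp_fst {X Y Z} `{coded X} `{coded Y} `{coded Z} (f : X -> Y * Z) :
  comp f -> comp (fun x => fst (f x)).
Proof.
intros Hf; generalize (computable_comp _ _ computable_fst Hf).
apply computable_ext; intros n; simpl; now rewrite Cantor.cancel_of_to.
Qed.

Lemma comp_snd {X Y Z} `{coded X} `{coded Y} `{coded Z} (f : X -> Y * Z) :
  comp f -> comp (fun x => snd (f x)).
Proof.
intros Hf; generalize (computable_comp _ _ computable_snd Hf).
apply computable_ext; intros n; simpl; now rewrite Cantor.cancel_of_to.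
Qed.

Lemma comp_enc {X Y} `{coded X} `{coded Y} (f : X -> Y) :
  comp f -> comp (fun x => enc (f x)).
Proof. exact (fun Hf => Hf). Qed.

Lemma comp_den {X Y} `{coded X} `{coded Y} (f : X -> nat) :
  comp f -> comp (fun x => den (f x) : Y).
Proof. apply computable_ext; intros n; now rewrite enc_den. Qed.

Lemma comp_succ {X} `{coded X} (f : X -> nat) :
  comp f -> comp (fun x => S (f x)).
Proof. exact (computable_comp _ _ computable_succ). Qed.

Lemma comp_cons {X Y} `{coded X} `{coded Y} (f : X -> Y) (g : X -> list Y) :
  comp f -> comp g -> comp (fun x => f x :: g x).
Proof.
intros Hf Hg; exact (computable_comp _ _ computable_succ (computable_pair _ _ Hf Hg)).
Qed.

Lemma skipn_succ {Y} i (l : list Y) : skipn (S i) l = tl (skipn i l).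
Proof.
revert l; induction i as [|i IH]; intros [|y l]; try reflexivity.
exact (IH l).
Qed.

(** The empty list needs no test: its code 0 decodes to the pair of zeros, so its tail again has
    code 0. *)
Lemma enc_tl {Y} `{coded Y} (l : list Y) :
  enc (tl l) = snd (Cantor.of_nat (pred (enc l))).
Proof. destruct l as [|y l]; simpl; [reflexivity|now rewrite Cantor.cancel_of_to]. Qed.

(** The one list recursion that is programmed directly; membership, length and quantification over
    entries are all expressed through [skipn]. *)
Lemma comp_skipn {X Y} `{coded X} `{coded Y} (f : X -> nat) (g : X -> list Y) :
  comp f -> comp g -> comp (fun x => skipn (f x) (g x)).
Proof.
intros Hf Hg.
eapply computable_ext;
  [|apply (computable_rec (fun n => n)
             (fun n => snd (Cantor.of_nat
                (pred (snd (Cantor.of_nat (snd (Cantor.of_nat n)))))))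
             (fun n => enc (g (den n))) (fun n => enc (f (den n))))].
- intros n; cbv beta; change (enc (f (den n))) with (f (den n)).
  induction (f (den n)) as [|m IH]; cbn [nat_rect]; [reflexivity|].
  rewrite skipn_succ, enc_tl, IH.
  now rewrite !Cantor.cancel_of_to; simpl; rewrite Cantor.cancel_of_to.
- apply computable_id.
- apply (computable_comp _ _ computable_snd),
    (computable_comp _ _ computable_pred).
  exact (computable_comp _ _ computable_snd computable_snd).
- exact Hg.
- exact Hf.
Qed.

(** The code serves as a computable bound for positions in a list, which avoids programming
    [length]. *)
Lemma length_le_enc {Y} `{coded Y} (l : list Y) : length l <= enc l.
Proof.
induction l as [|y l IH]; simpl; [lia|].
generalize (Cantor.to_nat_non_decreasing (enc y) (list_code (map enc l))).
simpl in IH; lia.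
Qed.

(** * Decidable and computably enumerable families *)

Section Families.

Variable K : graph -> Prop.
Variable B : graph -> nat -> Prop.

(** Decidability relative to the oracle [B G], uniformly in the description of a graph from [K]. *)
Definition decidable {X} `{coded X} (P : graph -> X -> Prop) : Prop :=
  exists T, indexable T /\
    forall G D, K G -> describes D G ->
      reduction (T D) (fun n => P G (den n)) (B G).

Lemma decidable_ext {X} `{coded X} (P Q : graph -> X -> Prop) :
  (forall G x, K G -> highly_computable G -> P G x <-> Q G x) ->
  decidable P -> decidable Q.
Proof.
intros HPQ [T [HT ET]]; exists T; split; [exact HT|].
intros G D HG HD n; destruct (ET G D HG HD n) as [E1 E0].
assert (HC : highly_computable G) by now exists D.
split; intros HQ; [apply E1|apply E0; contradict HQ]; now apply HPQ.
Qed.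

Lemma decidable_comp {X Y} `{coded X} `{coded Y} (f : X -> Y)
    (P : graph -> Y -> Prop) :
  comp f -> decidable P -> decidable (fun G x => P G (f x)).
Proof.
intros [c [Hc Ec]] [T [HT ET]]; exists (fun D => Comp (T D) c); split.
- apply indexable_comp; [exact HT|apply indexable_const].
- intros G D HG HD n.
  generalize (reduction_comp (T D) c _ _ (B G) (ET G D HG HD) (Ec (B G)) n).
  cbv beta; now rewrite den_enc.
Qed.

Lemma decidable_not {X} `{coded X} (P : graph -> X -> Prop) :
  decidable P -> decidable (fun G x => ~ P G x).
Proof.
intros [T [HT ET]]; exists (fun D => not_code (T D)); split.
- apply indexable_comp; [apply indexable_const|].
  apply indexable_pair; [apply indexable_const|exact HT].
- intros G D HG HD; apply (reduction_not (T D)), (ET G D HG HD).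
Qed.

Lemma indexable_and T U :
  indexable T -> indexable U -> indexable (fun D => and_code (T D) (U D)).
Proof.
intros HT HU; apply indexable_comp.
- apply indexable_prec; [apply indexable_const|].
  apply indexable_comp; [exact HU|apply indexable_const].
- apply indexable_pair; [apply indexable_const|exact HT].
Qed.

Lemma decidable_and {X} `{coded X} (P Q : graph -> X -> Prop) :
  decidable P -> decidable Q -> decidable (fun G x => P G x /\ Q G x).
Proof.
intros [T [HT ET]] [U [HU EU]]; exists (fun D => and_code (T D) (U D)).
split; [now apply indexable_and|].
intros G D HG HD; apply (reduction_and (T D) (U D)); [now apply ET|].
intros n _; now apply EU.
Qed.

Lemma decidable_or {X} `{coded X} (P Q : graph -> X -> Prop) :
  decidable P -> decidable Q -> decidable (fun G x => P G x \/ Q G x).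
Proof.
intros HP HQ.
apply (decidable_ext (fun G x => ~ (~ P G x /\ ~ Q G x))).
- intros G x _ _; tauto.
- now apply decidable_not, decidable_and; apply decidable_not.
Qed.

Lemma decidable_ball {X} `{coded X} (b : X -> nat) (P : graph -> X -> nat -> Prop) :
  comp b -> decidable (fun G p => P G (fst p) (snd p)) ->
  decidable (fun G x => forall i, i < b x -> P G x i).
Proof.
intros Hb [T [HT ET]].
assert (HP : decidable (fun G (p : X * nat) =>
                          forall i, i < snd p -> P G (fst p) i)).
{ exists (fun D => ball_code (T D)); split.
  - apply indexable_prec; [apply indexable_const|].
    apply indexable_and; [apply indexable_const|].
    apply indexable_comp; [exact HT|apply indexable_const].
  - intros G D HG HD n.
    generalize (reduction_ball (T D) _ (B G) (ET G D HG HD) n); simpl.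
    intros [E1 E0]; split; intros E.
    + apply E1; intros i Hi; rewrite Cantor.cancel_of_to; now apply E.
    + apply E0; contradict E; intros i Hi.
      generalize (E i Hi); now rewrite Cantor.cancel_of_to. }
exact (decidable_comp (fun x => (x, b x)) _ (comp_pair _ _ comp_id Hb) HP).
Qed.

Lemma decidable_zero {X} `{coded X} (f : X -> nat) :
  comp f -> decidable (fun _ x => f x = 0).
Proof.
intros [c [Hc Ec]]; exists (fun _ => not_code c).
split; [apply indexable_const|].
intros G D _ _ n; generalize (eval_not (B G) c n _ (Ec (B G) n)); simpl.
destruct (f (den n)); now split.
Qed.

Lemma decidable_eq {X Y} `{coded X} `{coded Y} (f g : X -> Y) :
  comp f -> comp g -> decidable (fun _ x => f x = g x).
Proof.
intros Hf Hg.
apply (decidable_ext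
  (fun _ x => (enc (f x) - enc (g x)) + (enc (g x) - enc (f x)) = 0)).
- intros _ x _ _; split.
  + intros E; apply enc_inj; lia.
  + intros ->; lia.
- apply decidable_zero.
  apply computable_add; now apply computable_sub.
Qed.

(** The only place where a program consults the oracle. *)
Lemma decidable_oracle {X} `{coded X} (f : X -> nat) :
  comp f -> decidable (fun G x => B G (f x)).
Proof.
intros Hf; apply (decidable_comp f (fun G n => B G n) Hf).
exists (fun _ => Oracle); split; [apply indexable_const|].
intros G D _ _ n; split; intros E; [now left|now right].
Qed.

Lemma decidable_vert {X} `{coded X} (f : X -> nat) :
  comp f -> decidable (fun G x => vert G (f x)).
Proof.
intros Hf; apply (decidable_comp f vert Hf).
exists vert_code; split; [apply indexable_vert|].
intros G D _ (_ & [Ho Hr] & _) n.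
split; intros E; apply (eval_oracle_free no_oracle); trivial; now apply Hr.
Qed.

Lemma decidable_adj {X} `{coded X} (f g : X -> nat) :
  comp f -> comp g -> decidable (fun G x => adj G (f x) (g x)).
Proof.
intros Hf Hg.
apply (decidable_comp (fun x => (f x, g x))
         (fun G p => adj G (fst p) (snd p)) (comp_pair _ _ Hf Hg)).
exists adj_code; split; [apply indexable_adj|].
intros G D _ (_ & _ & [Ho Hr] & _) n; simpl.
split; intros E; apply (eval_oracle_free no_oracle); trivial; apply Hr.
- exists (fst (Cantor.of_nat n)), (snd (Cantor.of_nat n)); split; [|exact E].
  now rewrite <- surjective_pairing, Cantor.cancel_to_of.
- contradict E; destruct E as (u & v & -> & E).
  now rewrite Cantor.cancel_of_to.
Qed.

Lemma degree_unique G v d d' : degree G v d -> degree G v d' -> d = d'.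
Proof.
intros (l & Hl & El & <-) (l' & Hl' & El' & <-).
apply Nat.le_antisymm; apply NoDup_incl_length; trivial;
  intros x Hx; [apply El', El, Hx|apply El, El', Hx].
Qed.

Lemma decidable_degree {X} `{coded X} (f g : X -> nat) :
  comp f -> comp g ->
  decidable (fun G x => vert G (f x) /\ degree G (f x) (g x)).
Proof.
intros Hf Hg.
apply (decidable_comp (fun x => (f x, g x))
  (fun G p => vert G (fst p) /\ degree G (fst p) (snd p)) (comp_pair _ _ Hf Hg)).
clear Hf Hg.
destruct (decidable_vert (fun p : nat * nat => fst p) (comp_fst _ comp_id))
  as [T [HT ET]].
destruct (decidable_eq (fun p : nat * nat => fst p) snd (comp_fst _ comp_id)
  (comp_snd _ comp_id)) as [U [HU EU]].
(* [T] tests for a vertex and guards the degree program, which may diverge elsewhere; [U] compares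
   the computed degree with the proposed one. *)
exists (fun D => and_code (T D) (Comp (U D) (Pair (Comp (deg_code D) Fst) Snd))).
split.
- apply indexable_and; [exact HT|].
  apply indexable_comp; [exact HU|].
  apply indexable_pair; [|apply indexable_const].
  apply indexable_comp; [apply indexable_deg|apply indexable_const].
- intros G D HG HD.
  apply (reduction_and (T D)
    (Comp (U D) (Pair (Comp (deg_code D) Fst) Snd))); [now apply ET|].
  intros n Hv.
  assert (HD' := HD); destruct HD' as (_ & _ & _ & Ho & Hdeg).
  destruct (Hdeg _ Hv) as (d & Hd & Ed); simpl in *.
  assert (E : eval (B G) (Pair (Comp (deg_code D) Fst) Snd) n
                (pair_code d (snd (Cantor.of_nat n)))).
  { exists d, (snd (Cantor.of_nat n)); split; [|now split].
    exists (fst (Cantor.of_nat n)); split; [reflexivity|].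
    now apply (eval_oracle_free no_oracle). }
  destruct (EU G D HG HD (pair_code d (snd (Cantor.of_nat n)))) as [E1 E0].
  rewrite !Cantor.cancel_of_to in E1, E0; simpl in E1, E0.
  split; intros E2; eexists; (split; [exact E|]).
  + apply E1, (degree_unique _ _ _ _ Hd E2).
  + apply E0; intros ->; contradiction.
Qed.

(** A relativised existential normal form with a single numerical witness; the closure properties
    below merge several witnesses into one by coding. *)
Definition ce {X} `{coded X} (P : graph -> X -> Prop) : Prop :=
  exists Q : graph -> X * nat -> Prop, decidable Q /\
    forall G x, K G -> highly_computable G ->
      P G x <-> exists m, Q G (x, m).

Lemma ce_ext {X} `{coded X} (P Q : graph -> X -> Prop) :
  (forall G x, K G -> highly_computable G -> P G x <-> Q G x) ->
  ce P -> ce Q.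
Proof.
intros HPQ [R [HR ER]]; exists R; split; [exact HR|].
intros G x HG HC; rewrite <- HPQ by trivial; now apply ER.
Qed.

Lemma ce_decidable {X} `{coded X} (P : graph -> X -> Prop) :
  decidable P -> ce P.
Proof.
intros HP; exists (fun G p => P G (fst p)); split.
- exact (decidable_comp (fun p : X * nat => fst p) P (comp_fst _ comp_id) HP).
- intros G x _ _; split; [now exists 0|intros [m E]; exact E].
Qed.

Lemma ce_comp {X Y} `{coded X} `{coded Y} (f : X -> Y) (P : graph -> Y -> Prop) :
  comp f -> ce P -> ce (fun G x => P G (f x)).
Proof.
intros Hf [Q [HQ EQ]]; exists (fun G p => Q G (f (fst p), snd p)); split.
- apply (decidable_comp (fun p : X * nat => (f (fst p), snd p))); trivial.
  apply comp_pair; [|exact (comp_snd _ comp_id)].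
  exact (comp_comp f fst Hf (comp_fst _ comp_id)).
- intros G x HG HC; now apply EQ.
Qed.

Lemma ce_and {X} `{coded X} (P Q : graph -> X -> Prop) :
  ce P -> ce Q -> ce (fun G x => P G x /\ Q G x).
Proof.
intros [R [HR ER]] [S [HS ES]].
exists (fun G p => R G (fst p, fst (den (snd p) : nat * nat)) /\
                   S G (fst p, snd (den (snd p) : nat * nat))); split.
- assert (H1 := comp_fst (fun p : X * nat => p) comp_id).
  assert (H2 := comp_den (Y := nat * nat) _ (comp_snd (fun p : X * nat => p) comp_id)).
  apply decidable_and;
    [apply (decidable_comp (fun p : X * nat =>
               (fst p, fst (den (snd p) : nat * nat))))
    |apply (decidable_comp (fun p : X * nat =>
               (fst p, snd (den (snd p) : nat * nat))))]; trivial;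
    apply comp_pair; trivial; [apply comp_fst|apply comp_snd]; exact H2.
- intros G x HG HC; rewrite ER, ES by trivial; split.
  + intros [[m Hm] [k Hk]]; exists (enc (m, k)); cbn [fst snd]; now rewrite den_enc.
  + intros [m [H1 H2]]; split; eexists; eassumption.
Qed.

Lemma ce_or {X} `{coded X} (P Q : graph -> X -> Prop) :
  ce P -> ce Q -> ce (fun G x => P G x \/ Q G x).
Proof.
intros [R [HR ER]] [S [HS ES]]; exists (fun G p => R G p \/ S G p).
split; [now apply decidable_or|].
intros G x HG HC; rewrite ER, ES by trivial; split.
- intros [[m Hm]|[m Hm]]; exists m; [now left|now right].
- intros [m [Hm|Hm]]; [left|right]; now exists m.
Qed.

Lemma ce_ex {X Y} `{coded X} `{coded Y} (P : graph -> X -> Y -> Prop) :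
  ce (fun G p => P G (fst p) (snd p)) -> ce (fun G x => exists y, P G x y).
Proof.
intros [Q [HQ EQ]].
exists (fun G p => Q G ((fst p, fst (den (snd p) : Y * nat)),
                        snd (den (snd p) : Y * nat))); split.
- apply (decidable_comp (fun p : X * nat =>
    ((fst p, fst (den (snd p) : Y * nat)), snd (den (snd p) : Y * nat))));
    trivial.
  assert (H1 := comp_fst (fun p : X * nat => p) comp_id).
  assert (H2 := comp_den (Y := Y * nat) _ (comp_snd (fun p : X * nat => p) comp_id)).
  apply comp_pair; [apply comp_pair; trivial; now apply comp_fst|now apply comp_snd].
- intros G x HG HC; split.
  + intros [y Hy]; apply (EQ G (x, y) HG HC) in Hy; destruct Hy as [m Hm].
    exists (enc (y, m)); cbn [fst snd]; now rewrite den_enc.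
  + intros [m Hm]; exists (fst (den m : Y * nat)).
    apply (EQ G (x, _) HG HC); eexists; exact Hm.
Qed.

Lemma bounded_choice (P : nat -> nat -> Prop) b :
  (forall i, i < b -> exists m, P i m) ->
  exists l : list nat, forall i, i < b -> P i (hd 0 (skipn i l)).
Proof.
revert P; induction b as [|b IH]; intros P HP; [exists []; lia|].
destruct (IH (fun i => P (S i))) as [l Hl]; [intros i Hi; apply HP; lia|].
destruct (HP 0) as [m Hm]; [lia|].
exists (m :: l); intros [|i] Hi; [exact Hm|]; apply Hl; lia.
Qed.

Lemma comp_hd {X} `{coded X} (f : X -> list nat) :
  comp f -> comp (fun x => hd 0 (f x)).
Proof.
intros Hf.
generalize (computable_comp _ _ computable_fst
              (computable_comp _ _ computable_pred Hf)).
apply computable_ext; intros n; destruct (f (den n)); simpl; [reflexivity|].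
now rewrite Cantor.cancel_of_to.
Qed.

(** The witnesses for the finitely many indices are gathered in one coded list, whose entry at [i]
    is read as [hd 0 (skipn i l)]. *)
Lemma ce_ball {X} `{coded X} (b : X -> nat) (P : graph -> X -> nat -> Prop) :
  comp b -> ce (fun G p => P G (fst p) (snd p)) ->
  ce (fun G x => forall i, i < b x -> P G x i).
Proof.
intros Hb [Q [HQ EQ]].
exists (fun G p => forall i, i < b (fst p) ->
          Q G ((fst p, i), hd 0 (skipn i (den (snd p) : list nat)))); split.
- apply decidable_ball; [exact (comp_comp b fst Hb (comp_fst _ comp_id))|].
  apply (decidable_comp (fun p : X * nat * nat =>
    ((fst (fst p), snd p), hd 0 (skipn (snd p) (den (snd (fst p)) : list nat)))));
    trivial.
  apply comp_pair.
  + apply comp_pair; [apply comp_fst, comp_fst|apply comp_snd]; exact comp_id.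
  + apply comp_hd, comp_skipn; [exact (comp_snd _ comp_id)|].
    apply comp_den, comp_snd, comp_fst; exact comp_id.
- intros G x HG HC; split.
  + intros HP; destruct (bounded_choice (fun i m => Q G ((x, i), m)) (b x))
      as [l Hl].
    * intros i Hi; now apply (EQ G (x, i) HG HC), HP.
    * exists (enc l); intros i Hi; cbn [fst snd]; rewrite den_enc; now apply Hl.
  + intros [m Hm] i Hi; apply (EQ G (x, i) HG HC); eexists; exact (Hm i Hi).
Qed.

(** Post's theorem, relativised and uniform: search for the first number witnessing membership or
    non-membership, then check which of the two it witnesses. *)
Lemma uniform_reduction {X} `{coded X} (A : graph -> X -> Prop) :
  ce A -> ce (fun G x => ~ A G x) ->
  uniform_turing_le K (fun G n => A G (den n)) B.
Proof.
intros [Q [HQ EQ]] [R [HR ER]].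
(* [Mu] looks for a zero, so the condition searched for is negated. *)
destruct (decidable_not _ (decidable_or _ _ HQ HR)) as [T [HT ET]].
destruct HQ as [U [HU EU]].
set (V D := Comp (U D) (Pair identity_code (Mu (T D)))).
assert (HV : indexable V).
{ apply indexable_comp; [exact HU|].
  apply indexable_pair; [apply indexable_const|now apply indexable_mu]. }
destruct HV as [f [Hf Ef]]; exists f; split; [exact Hf|].
intros G D HG HD; exists (V D); split; [apply Ef|].
assert (HC : highly_computable G) by now exists D.
specialize (ET G D HG HD); specialize (EU G D HG HD).
intros n.
set (S m := Q G (den n, m) \/ R G (den n, m)).
assert (HS : exists m, S m).
{ destruct (classic (A G (den n))) as [E|E].
  - apply (EQ G _ HG HC) in E; destruct E as [m E]; exists m; now left.
  - apply (ER G _ HG HC) in E; destruct E as [m E]; exists m; now right. }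
assert (HM : exists m, S m /\ forall i, i < m -> ~ S i).
{ destruct (dec_inh_nat_subset_has_unique_least_element S
    (fun m => classic (S m)) HS) as [m [[H1 H2] _]].
  exists m; split; [exact H1|]; intros i Hi Si; specialize (H2 i Si); lia. }
destruct HM as [m [Hm Hmin]].
assert (EP : eval (B G) (Pair identity_code (Mu (T D))) n (pair_code n m)).
{ exists n, m; split; [apply eval_identity|split; [|reflexivity]].
  assert (EN : forall i, den (pair_code n i) = (den n, i) :> X * nat)
    by (intros i; simpl; now rewrite Cantor.cancel_of_to).
  split.
  - apply ET; rewrite EN; unfold S in Hm; tauto.
  - intros i Hi; exists 0; apply ET; rewrite EN; exact (Hmin i Hi). }
(* If [m] is not a witness of membership it is one of non-membership, so testing [Q] at [m] settles
   the question. *)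
assert (EQm : A G (den n) <-> Q G (den n, m)).
{ split.
  - intros E; destruct Hm as [Hm|Hm]; [exact Hm|].
    exfalso; apply (proj2 (ER G (den n) HG HC)); [now exists m|exact E].
  - intros E; apply (EQ G _ HG HC); now exists m. }
generalize (EU (pair_code n m)); simpl; rewrite Cantor.cancel_of_to; simpl.
intros [E1 E0].
split; intros E; exists (pair_code n m); (split; [exact EP|]).
- now apply E1, EQm.
- apply E0; now rewrite <- EQm.
Qed.

(** * Atomic formulas and quantifiers over lists, neighbours and walks *)

Lemma ce_eq {X Y} `{coded X} `{coded Y} (f g : X -> Y) :
  comp f -> comp g -> ce (fun _ x => f x = g x).
Proof. now intros; apply ce_decidable, decidable_eq. Qed.

Lemma ce_neq {X Y} `{coded X} `{coded Y} (f g : X -> Y) :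
  comp f -> comp g -> ce (fun _ x => f x <> g x).
Proof. now intros; apply ce_decidable, decidable_not, decidable_eq. Qed.

Lemma ce_adj {X} `{coded X} (f g : X -> nat) :
  comp f -> comp g -> ce (fun G x => adj G (f x) (g x)).
Proof. now intros; apply ce_decidable, decidable_adj. Qed.

Lemma ce_not_adj {X} `{coded X} (f g : X -> nat) :
  comp f -> comp g -> ce (fun G x => ~ adj G (f x) (g x)).
Proof. now intros; apply ce_decidable, decidable_not, decidable_adj. Qed.

Lemma ce_vert {X} `{coded X} (f : X -> nat) :
  comp f -> ce (fun G x => vert G (f x)).
Proof. now intros; apply ce_decidable, decidable_vert. Qed.

Lemma ce_not_vert {X} `{coded X} (f : X -> nat) :
  comp f -> ce (fun G x => ~ vert G (f x)).
Proof. now intros; apply ce_decidable, decidable_not, decidable_vert. Qed.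

(** The condition sees an entry together with what follows it; this one scheme covers bounded
    quantification, absence of repetitions and walks along a relation. *)
Fixpoint all_suffixes {Y} (P : Y -> list Y -> Prop) (l : list Y) : Prop :=
  match l with
  | [] => True
  | y :: t => P y t /\ all_suffixes P t
  end.

(** Positions past the end give the empty suffix and impose nothing, so any [n] at least the length
    will do, in particular the code of [l]. *)
Lemma all_suffixes_skipn {Y} (P : Y -> list Y -> Prop) n l :
  length l <= n ->
  all_suffixes P l <->
  forall i, i < n ->
    skipn i l = [] \/ exists y t, skipn i l = y :: t /\ P y t.
Proof.
revert n; induction l as [|y l IH]; intros n Hn.
- split; [intros _ i _; left; apply skipn_nil|easy].
- destruct n as [|n]; [simpl in Hn; lia|]; simpl in Hn.
  simpl; rewrite (IH n) by lia; split.
  + intros [Hy Hl] [|i] Hi; [right; now exists y, l|].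
    apply (Hl i); lia.
  + intros HP; split.
    * destruct (HP 0) as [E|(y' & t & E & Hy)]; [lia|discriminate|].
      simpl in E; injection E as -> ->; exact Hy.
    * intros i Hi; apply (HP (S i)); lia.
Qed.

Lemma ce_all_suffixes {X Y} `{coded X} `{coded Y} (l : X -> list Y)
    (P : graph -> X -> Y -> list Y -> Prop) :
  comp l -> ce (fun G p => P G (fst (fst p)) (snd (fst p)) (snd p)) ->
  ce (fun G x => all_suffixes (P G x) (l x)).
Proof.
intros Hl HP.
eapply ce_ext;
  [intros G x _ _; symmetry; apply (all_suffixes_skipn _ (enc (l x))),
     length_le_enc|].
apply ce_ball; [exact Hl|]; cbv beta.
assert (Hs : comp (fun p : X * nat => skipn (snd p) (l (fst p)))).
{ apply comp_skipn; [exact (comp_snd _ comp_id)|].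
  exact (comp_comp l fst Hl (comp_fst _ comp_id)). }
apply ce_or; [exact (ce_eq _ _ Hs (comp_const _))|].
apply ce_ex, ce_ex; cbv beta; apply ce_and.
- apply ce_eq.
  + apply (comp_comp _ (fun p : X * nat * Y * list Y => fst (fst p)) Hs).
    apply comp_fst, comp_fst; exact comp_id.
  + apply comp_cons; [apply comp_snd, comp_fst|apply comp_snd]; exact comp_id.
- apply (ce_comp (fun p : X * nat * Y * list Y =>
                    (fst (fst (fst p)), snd (fst p), snd p))
           (fun G p => P G (fst (fst p)) (snd (fst p)) (snd p))); [|exact HP].
  apply comp_pair; [apply comp_pair|];
    [apply comp_fst, comp_fst, comp_fst|apply comp_snd, comp_fst|apply comp_snd];
    exact comp_id.
Qed.

Lemma ce_forall_in {X Y} `{coded X} `{coded Y} (l : X -> list Y)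
    (P : graph -> X -> Y -> Prop) :
  comp l -> ce (fun G p => P G (fst p) (snd p)) ->
  ce (fun G x => forall y, In y (l x) -> P G x y).
Proof.
intros Hl HP.
apply (ce_ext (fun G x => all_suffixes (fun y _ => P G x y) (l x))).
- intros G x _ _; induction (l x) as [|y t IH]; simpl; [easy|].
  rewrite IH; split.
  + intros [Hy Ht] z [->|Hz]; auto.
  + intros Ht; split; auto.
- apply ce_all_suffixes; [exact Hl|].
  apply (ce_comp (fun p : X * Y * list Y => fst p)
           (fun G p => P G (fst p) (snd p))); [exact (comp_fst _ comp_id)|exact HP].
Qed.

Lemma in_skipn {Y} (y : Y) l : In y l <-> exists i t, skipn i l = y :: t.
Proof.
split.
- intros Hy; apply in_split in Hy; destruct Hy as (l1 & l2 & ->).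
  exists (length l1), l2; rewrite skipn_app, skipn_all, Nat.sub_diag; reflexivity.
- intros (i & t & E); rewrite <- (firstn_skipn i l), E.
  apply in_or_app; right; now left.
Qed.

Lemma ce_in {X Y} `{coded X} `{coded Y} (f : X -> Y) (l : X -> list Y) :
  comp f -> comp l -> ce (fun _ x => In (f x) (l x)).
Proof.
intros Hf Hl.
eapply ce_ext; [intros G x _ _; symmetry; apply in_skipn|].
apply ce_ex, ce_ex; cbv beta; apply ce_eq.
- apply comp_skipn; [apply comp_snd, comp_fst; exact comp_id|].
  apply (comp_comp l (fun p => fst (fst p)) Hl), comp_fst, comp_fst, comp_id.
- apply comp_cons; [|apply comp_snd, comp_id].
  apply (comp_comp f (fun p => fst (fst p)) Hf), comp_fst, comp_fst, comp_id.
Qed.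

Lemma ce_not_in {X Y} `{coded X} `{coded Y} (f : X -> Y) (l : X -> list Y) :
  comp f -> comp l -> ce (fun _ x => ~ In (f x) (l x)).
Proof.
intros Hf Hl.
apply (ce_ext (fun _ x => forall y, In y (l x) -> y <> f x)).
- intros _ x _ _; split.
  + intros HN Hx; exact (HN _ Hx eq_refl).
  + intros HN y Hy ->; contradiction.
- apply ce_forall_in; [exact Hl|]; apply ce_neq; [exact (comp_snd _ comp_id)|].
  exact (comp_comp f fst Hf (comp_fst _ comp_id)).
Qed.

Lemma ce_nodup {X Y} `{coded X} `{coded Y} (l : X -> list Y) :
  comp l -> ce (fun _ x => NoDup (l x)).
Proof.
intros Hl.
apply (ce_ext (fun _ x => all_suffixes (fun y t => ~ In y t) (l x))).
- intros _ x _ _; induction (l x) as [|y t IH]; simpl.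
  + split; [constructor|easy].
  + now rewrite NoDup_cons_iff, IH.
- apply ce_all_suffixes; [exact Hl|].
  apply ce_not_in; [apply comp_snd, comp_fst|apply comp_snd]; exact comp_id.
Qed.

(** The predecessor of the length is the position whose suffix is a singleton; this makes the length
    expressible by [skipn]. *)
Lemma length_skipn_iff {Y} (l : list Y) d :
  length l = d <->
  (l = [] /\ d = 0) \/ exists k y, d = S k /\ skipn k l = [y].
Proof.
split.
- intros <-; destruct l as [|y l _] using rev_ind; [now left|right].
  exists (length l), y; rewrite length_app, Nat.add_comm; split; [reflexivity|].
  rewrite skipn_app, skipn_all, Nat.sub_diag; reflexivity.
- intros [[-> ->]|(k & y & -> & E)]; [reflexivity|].
  assert (EL := length_skipn k l); rewrite E in EL; simpl in EL; lia.
Qed.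

Lemma ce_length {X Y} `{coded X} `{coded Y} (l : X -> list Y) (d : X -> nat) :
  comp l -> comp d -> ce (fun _ x => length (l x) = d x).
Proof.
intros Hl Hd.
eapply ce_ext; [intros G x _ _; symmetry; apply length_skipn_iff|].
apply ce_or; [apply ce_and; apply ce_eq; trivial; apply comp_const|].
apply ce_ex, ce_ex; cbv beta; apply ce_and; apply ce_eq.
- apply (comp_comp d (fun p => fst (fst p)) Hd), comp_fst, comp_fst, comp_id.
- apply comp_succ, comp_snd, comp_fst, comp_id.
- apply comp_skipn; [apply comp_snd, comp_fst; exact comp_id|].
  apply (comp_comp l (fun p => fst (fst p)) Hl), comp_fst, comp_fst, comp_id.
- apply comp_cons; [apply comp_snd, comp_id|apply comp_const].
Qed.

(* The computability of the degree is what makes it possible to verify that a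
   finite list contains all the neighbours of a vertex. *)
Lemma forall_neighbours_iff G v (P : nat -> Prop) :
  highly_computable G ->
  (vert G v /\ forall b, adj G v b -> P b) <->
  exists l, (exists d, (vert G v /\ degree G v d) /\ length l = d) /\
    NoDup l /\ forall b, In b l -> adj G v b /\ P b.
Proof.
intros [D (_ & _ & _ & _ & HD)]; split.
- intros [Hv HP]; destruct (HD v Hv) as (d & Hd & _).
  assert (Hd' := Hd); destruct Hd' as (l & Hl & El & Ed).
  exists l; split; [now exists d|]; split; [exact Hl|].
  intros b Hb; apply El in Hb; auto.
- intros (l & (d & [Hv (l' & Hl' & El' & Ed')] & Ed) & Hl & HP).
  split; [exact Hv|]; intros b Hb; apply HP.
  (* A list of neighbours without repetition, as long as the degree, exhausts the neighbours. *)
  assert (HI : incl l' l).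
  { apply NoDup_length_incl; [exact Hl|lia|].
    intros z Hz; apply El', HP, Hz. }
  apply HI, El', Hb.
Qed.

(** Guessing the complete list of neighbours turns the universal quantifier over them into an
    existential one followed by a bounded one. *)
Lemma ce_forall_neighbours {X} `{coded X} (f : X -> nat)
    (P : graph -> X -> nat -> Prop) :
  comp f -> ce (fun G p => P G (fst p) (snd p)) ->
  ce (fun G x => vert G (f x) /\ forall b, adj G (f x) b -> P G x b).
Proof.
intros Hf HP.
eapply ce_ext; [intros G x _ HC; symmetry; now apply forall_neighbours_iff|].
apply ce_ex; cbv beta; apply ce_and; [|apply ce_and].
- apply ce_ex; cbv beta; apply ce_and.
  + apply ce_decidable, decidable_degree; [|exact (comp_snd _ comp_id)].
    apply (comp_comp f (fun p => fst (fst p)) Hf), comp_fst, comp_fst, comp_id.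
  + apply ce_length; [apply comp_snd, comp_fst|apply comp_snd]; exact comp_id.
- apply ce_nodup; exact (comp_snd _ comp_id).
- apply ce_forall_in; [exact (comp_snd _ comp_id)|]; apply ce_and.
  + apply ce_adj; [|exact (comp_snd _ comp_id)].
    apply (comp_comp f (fun p => fst (fst p)) Hf), comp_fst, comp_fst, comp_id.
  + apply (ce_comp (fun p : X * list nat * nat => (fst (fst p), snd p))
             (fun G p => P G (fst p) (snd p))); [|exact HP].
    apply comp_pair; [apply comp_fst, comp_fst|apply comp_snd]; exact comp_id.
Qed.

Definition chain (R : nat -> nat -> Prop) : list nat -> Prop :=
  all_suffixes (fun y t => t = [] \/ exists z s, t = z :: s /\ R y z).

(** A finite walk is the witness; that it ends at [b] is said by a singleton suffix, in keeping with
    the use of [skipn]. *)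
Lemma reach_chain (R : nat -> nat -> Prop) a b :
  clos_refl_trans nat R a b <->
  exists t, (exists i, skipn i (a :: t) = [b]) /\ chain R (a :: t).
Proof.
split.
- intros HR; apply clos_rt_rt1n in HR; induction HR as [a|a c b Hac Hcb IH].
  + exists []; split; [now exists 0|]; split; [now left|exact I].
  + destruct IH as (t & [i Ei] & Ht); exists (c :: t).
    split; [now exists (S i)|]; split; [|exact Ht].
    right; now exists c, t.
- intros (t & [i Ei] & Ht); revert a i Ei Ht.
  induction t as [|c t IH]; intros a i Ei Ht.
  + destruct i as [|i]; [injection Ei as ->; apply rt_refl|].
    simpl in Ei; rewrite skipn_nil in Ei; discriminate.
  + destruct i as [|i]; [discriminate|].
    destruct Ht as [[E|(z & s & E & HR)] Ht']; [discriminate|].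
    injection E as <- <-; apply rt_trans with c; [now apply rt_step|].
    now apply (IH c i).
Qed.

Lemma ce_reach {X} `{coded X} (f g : X -> nat)
    (R : graph -> X -> nat -> nat -> Prop) :
  comp f -> comp g ->
  ce (fun G p => R G (fst (fst p)) (snd (fst p)) (snd p)) ->
  ce (fun G x => clos_refl_trans nat (R G x) (f x) (g x)).
Proof.
intros Hf Hg HR.
eapply ce_ext; [intros G x _ _; symmetry; apply reach_chain|].
assert (Hc : comp (fun p : X * list nat => f (fst p) :: snd p)).
{ apply comp_cons; [|exact (comp_snd _ comp_id)].
  exact (comp_comp f fst Hf (comp_fst _ comp_id)). }
apply ce_ex; cbv beta; apply ce_and.
- apply ce_ex; cbv beta; apply ce_eq.
  + apply comp_skipn; [exact (comp_snd _ comp_id)|].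
    exact (comp_comp _ fst Hc (comp_fst _ comp_id)).
  + apply comp_cons; [|apply comp_const].
    apply (comp_comp g (fun p => fst (fst p)) Hg), comp_fst, comp_fst, comp_id.
- apply (ce_all_suffixes (fun p : X * list nat => f (fst p) :: snd p)
    (fun G p y t => t = [] \/ exists z s, t = z :: s /\ R G (fst p) y z) Hc).
  apply ce_or; [apply ce_eq; [exact (comp_snd _ comp_id)|apply comp_const]|].
  apply ce_ex, ce_ex; cbv beta; apply ce_and.
  + apply ce_eq; [apply comp_snd, comp_fst, comp_fst, comp_id|].
    apply comp_cons; [apply comp_snd, comp_fst|apply comp_snd]; exact comp_id.
  + apply (ce_comp (fun p : X * list nat * nat * list nat * nat * list nat =>
        (fst (fst (fst (fst (fst p)))), snd (fst (fst (fst p))), snd (fst p)))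
      (fun G p => R G (fst (fst p)) (snd (fst p)) (snd p))); [|exact HR].
    repeat apply comp_pair; repeat (apply comp_fst || apply comp_snd);
      exact comp_id.
Qed.

End Families.

(** * Infinite sets and reachability *)

Notation reach R := (clos_refl_trans nat R).

Lemma not_infinite (A : nat -> Prop) :
  ~ infinite_set A -> exists l, forall x, A x -> In x l.
Proof. intros HA; now apply NNPP. Qed.

Lemma infinite_mono (A A' : nat -> Prop) :
  (forall x, A x -> A' x) -> infinite_set A -> infinite_set A'.
Proof. intros HA Hinf [l Hl]; apply Hinf; exists l; auto. Qed.

(** Infinite pigeonhole principle: finitely many finite sets cover only a finite set. *)
Lemma infinite_union (A : nat -> Prop) (P : nat -> nat -> Prop) l :
  infinite_set A -> (forall z, A z -> exists x, In x l /\ P x z) ->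
  exists x, In x l /\ infinite_set (P x).
Proof.
intros HA HP; apply NNPP; intros HN; apply HA.
cut (exists l', forall x z, In x l -> P x z -> In z l').
{ intros [l' Hl']; exists l'; intros z Hz.
  destruct (HP z Hz) as (x & Hx & Hxz); eauto. }
clear HA HP; induction l as [|x l IH]; [now exists []|].
destruct IH as [l' Hl'].
{ intros (y & Hy & Hi); apply HN; exists y; split; [now right|exact Hi]. }
destruct (not_infinite (P x)) as [l'' Hl''].
{ intros Hi; apply HN; exists x; split; [now left|exact Hi]. }
exists (l'' ++ l'); intros y z [->|Hy] Hz; apply in_or_app; eauto.
Qed.

Lemma infinite_injection (A : nat -> Prop) (p : nat -> nat) :
  (forall i, A (p i)) -> (forall i j, p i = p j -> i = j) -> infinite_set A.
Proof.
intros HA Hp [l Hl].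
assert (HN : NoDup (map p (seq 0 (S (length l))))).
{ apply NoDup_map_NoDup_ForallPairs; [|apply seq_NoDup].
  intros i j _ _; apply Hp. }
assert (HI : incl (map p (seq 0 (S (length l)))) l).
{ intros x Hx; apply in_map_iff in Hx; destruct Hx as (i & <- & _); auto. }
generalize (NoDup_incl_length HN HI); rewrite length_map, length_seq; lia.
Qed.

(** [P] need not be decidable, so the filtering is by excluded middle. *)
Lemma filter_prop {X} (P : X -> Prop) (l : list X) :
  exists l', forall x, In x l' <-> In x l /\ P x.
Proof.
induction l as [|x l [l' IH]]; [now exists []|].
destruct (classic (P x)) as [Hx|Hx].
- exists (x :: l'); intros y; simpl; rewrite IH; split.
  + intros [->|[H1 H2]]; auto.
  + intros [[->|H1] H2]; auto.
- exists l'; intros y; simpl; rewrite IH; split.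
  + intros [H1 H2]; auto.
  + intros [[->|H1] H2]; [contradiction|auto].
Qed.

Lemma reach_mono (R R' : nat -> nat -> Prop) a b :
  (forall x y, R x y -> R' x y) -> reach R a b -> reach R' a b.
Proof.
intros HR; induction 1 as [x y Hxy|x|x y z _ IH1 _ IH2];
  [now apply rt_step, HR|apply rt_refl|now apply rt_trans with y].
Qed.

Lemma reach_sym (R : nat -> nat -> Prop) a b :
  (forall x y, R x y -> R y x) -> reach R a b -> reach R b a.
Proof.
intros HR; induction 1 as [x y Hxy|x|x y z _ IH1 _ IH2];
  [now apply rt_step, HR|apply rt_refl|now apply rt_trans with y].
Qed.

Lemma reach_ind (R : nat -> nat -> Prop) (P : nat -> Prop) a :
  P a -> (forall x y, reach R a x -> P x -> R x y -> P y) ->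
  forall b, reach R a b -> P b.
Proof.
intros Ha HS b Hab; apply clos_rt_rtn1 in Hab.
induction Hab as [|x y Hxy Hax IH]; [exact Ha|].
apply (HS x); trivial; now apply clos_rtn1_rt.
Qed.

(** The inclusion of relations is only needed at points reachable from the start, so an invariant of
    the class may be used at each step. *)
Lemma reach_sub (R R' : nat -> nat -> Prop) a b :
  (forall x y, reach R a x -> R x y -> R' x y) -> reach R a b -> reach R' a b.
Proof.
intros HR; revert b; apply reach_ind; [apply rt_refl|].
intros x y Hax Hx Hxy; apply rt_trans with x; [exact Hx|].
now apply rt_step, HR.
Qed.

Lemma infinite_reach_step (R : nat -> nat -> Prop) a :
  infinite_set (reach R a) -> exists b, R a b.
Proof.
intros Hi; apply NNPP; intros HN; apply Hi; exists [a].
apply reach_ind; [now left|].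
intros y z _ [<-|[]] Hz; exfalso; apply HN; now exists z.
Qed.

Lemma neighbours_list G l :
  locally_finite G -> exists l', forall t b, In t l -> adj G t b -> In b l'.
Proof.
intros HL; induction l as [|t l [l' IH]]; [now exists []|].
destruct (classic (vert G t)) as [Ht|Ht].
- destruct (HL t Ht) as [l'' Hl'']; exists (l'' ++ l').
  intros t' b [->|Ht'] Hb; apply in_or_app; eauto.
(* [locally_finite] speaks of vertices only, but any other number has no neighbours. *)
- exists l'; intros t' b [<-|Ht'] Hb; [|eauto].
  exfalso; apply Ht; now apply adj_vert with b.
Qed.

Definition outside (R : nat -> nat -> Prop) (T : list nat) (a b : nat) : Prop :=
  R a b /\ ~ In a T /\ ~ In b T.

(** Cut a walk from [u] after its last visit to the finite set [T]: its end lies in [T] or is joined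
    outside [T] to a neighbour of [T]. There are finitely many such neighbours, so one of them has
    an infinite class. *)
Lemma infinite_class_outside G (R : nat -> nat -> Prop) T u :
  locally_finite G -> (forall a b, R a b -> adj G a b) -> In u T ->
  infinite_set (reach R u) ->
  exists t c, In t T /\ R t c /\ reach R u c /\ ~ In c T /\
    infinite_set (reach (outside R T) c).
Proof.
intros HL HR Hu Hi; destruct (neighbours_list G T HL) as [N HN].
(* Each point is assigned an anchor [c]: a point of [T] is its own anchor, any other has the vertex
   just after the last visit to [T]. *)
destruct (infinite_union (reach R u)
  (fun c z => (c = z /\ In z T) \/
     exists t, In t T /\ R t c /\ reach R u c /\ ~ In c T /\
       reach (outside R T) c z) (T ++ N) Hi) as (c & Hc & Hci).
- apply reach_ind.
  + exists u; split; [apply in_or_app; now left|now left].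
  + intros x y Hux (c & Hc & Hcx) Hxy.
    assert (Huy : reach R u y) by (apply rt_trans with x; auto using rt_step).
    destruct (classic (In y T)) as [Hy|Hy].
    { exists y; split; [apply in_or_app; now left|now left]. }
    destruct Hcx as [[-> Hx]|(t & Ht & Htc & Huc & HcT & Hcx)].
    * exists y; split; [apply in_or_app; right; eauto|right].
      exists x; repeat split; trivial; apply rt_refl.
    * exists c; split; [exact Hc|right]; exists t.
      repeat split; trivial; apply rt_trans with x; [exact Hcx|].
      apply rt_step; split; [exact Hxy|split; [|exact Hy]].
      clear Hux Hxy; revert x Hcx; apply reach_ind; [exact HcT|].
      intros p q _ _ [_ [_ Hq]]; exact Hq.
(* An anchor of the first kind accounts for one point only, so an infinite share means the second
   kind. *)
- destruct (classic (exists t, In t T /\ R t c /\ reach R u c /\ ~ In c T))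
    as [(t & Ht & Htc & Huc & HcT)|HE].
  + exists t, c; repeat split; trivial.
    revert Hci; apply infinite_mono.
    intros z [[-> Hz]|(t' & _ & _ & _ & _ & Hz)]; [contradiction|exact Hz].
  + exfalso; apply Hci; exists [c]; intros z [[-> _]|(t & H1 & H2 & H3 & H4 & _)].
    * now left.
    * exfalso; apply HE; now exists t.
Qed.

(** * Extendable paths *)

(** Adjacency once the vertices of [w] other than [u] are removed; when [u] ends the path [w], its
    class is where continuations of [w] live. *)
Definition beyond (G : graph) (w : list nat) (u a b : nat) : Prop :=
  adj G a b /\ (In a w -> a = u) /\ (In b w -> b = u).

(** * Koenig's lemma for simple paths *)

Lemma simple_path_rcons G w v u :
  simple_path G (w ++ [u]) -> adj G u v -> ~ In v (w ++ [u]) ->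
  simple_path G ((w ++ [u]) ++ [v]).
Proof.
intros [(H1 & H2 & H3) H4] Hv Hn; repeat split.
- intros E; apply app_eq_nil in E; destruct E; discriminate.
- apply Forall_app; split; [exact H2|]; constructor; [|constructor].
  now apply adj_vert with u, adj_sym.
- intros i Hi; rewrite length_app in Hi; simpl in Hi.
  destruct (Nat.eq_dec (S i) (length (w ++ [u]))) as [E|E].
  + rewrite (app_nth1 (w ++ [u]) [v] 0 (n := i)) by lia.
    rewrite E, (app_nth2 (w ++ [u]) [v]), Nat.sub_diag by lia; simpl.
    rewrite length_app in E; simpl in E.
    rewrite app_nth2 by lia; replace (i - length w) with 0 by lia; exact Hv.
  + rewrite !(app_nth1 _ [v]) by lia; apply H3; lia.
- apply NoDup_app; [exact H4|repeat constructor; easy|].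
  intros x Hx [->|[]]; contradiction.
Qed.

(** The invariant of the construction. Words are kept reversed, so that prolonging the path is a
    [cons] and its current end is the head. *)
Definition escaping (G : graph) (r : list nat) : Prop :=
  exists u r', r = u :: r' /\ simple_path G (rev r) /\
    infinite_set (reach (beyond G r u) u).

Lemma escaping_step G r :
  locally_finite G -> escaping G r -> exists v, escaping G (v :: r).
Proof.
intros HL (u & r' & -> & Hr & Hi).
(* Removing only the current end [u] leaves an infinite class at one of its neighbours, which
   becomes the next vertex. *)
destruct (infinite_class_outside G _ [u] u HL
  (fun a b H => proj1 H) (or_introl eq_refl) Hi)
  as (t & c & [<-|[]] & (Huc & _ & Hc) & _ & Hcu & Hci).
assert (Hcr : ~ In c (u :: r')).
{ intros Hin; apply Hcu; left; symmetry; now apply Hc. }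
exists c, c, (u :: r'); split; [reflexivity|]; split.
- apply simple_path_rcons; trivial.
  change (~ In c (rev (u :: r'))); now rewrite <- in_rev.
- revert Hci; apply infinite_mono; intros z; apply reach_mono.
  intros a b ((Hab & Ha & Hb) & Hau & Hbu); split; [exact Hab|].
  split; (intros [E|Hin]; [now symmetry|exfalso]).
  + apply Hau; left; symmetry; now apply Ha.
  + apply Hbu; left; symmetry; now apply Hb.
Qed.

Lemma infinite_path_of_escaping G r :
  locally_finite G -> escaping G r ->
  exists p, infinite_simple_path G p /\
    forall i, i < length r -> nth i (rev r) 0 = p i.
Proof.
intros HL Hr.
assert (lr : 0 < length r)
  by (destruct Hr as (u & r' & -> & _); simpl; lia).
set (state := {s : list nat | escaping G s}).
(* Dependent choice: prolongation is made a function on escaping words and then iterated. *)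
assert (next : forall s : state, {s' : state | exists v, proj1_sig s' = v :: proj1_sig s}).
{ intros [s Hs]; apply constructive_indefinite_description.
  destruct (escaping_step G s HL Hs) as [v Hv].
  now exists (exist _ (v :: s) Hv), v. }
set (q := fun n => nat_rect (fun _ => state) (exist _ r Hr)
            (fun _ s => proj1_sig (next s)) n).
set (l := fun n => rev (proj1_sig (q n))).
assert (lS : forall n, exists v, l (S n) = l n ++ [v]).
{ intros n; unfold l; simpl; destruct (next (q n)) as [s' [v Hv]]; simpl.
  exists v; now rewrite Hv. }
assert (lD : forall n k, exists t, l (n + k) = l n ++ t).
{ intros n k; induction k as [|k [t IH]].
  - exists []; now rewrite Nat.add_0_r, app_nil_r.
  - rewrite Nat.add_succ_r; destruct (lS (n + k)) as [v ->].
    exists (t ++ [v]); now rewrite IH, app_assoc. }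
assert (lL : forall n, length (l n) = length r + n).
{ intros n; induction n as [|n IH].
  - unfold l; simpl; rewrite length_rev; lia.
  - destruct (lS n) as [v ->]; rewrite length_app, IH; simpl; lia. }
assert (lP : forall n, simple_path G (l n)).
{ intros n; unfold l; destruct (q n) as [s Hs]; simpl.
  destruct Hs as (u & s' & _ & Hs & _); exact Hs. }
(* [l i] has length [length r + i], more than [i] because [r] is nonempty, so the default 0 is never
   read. *)
set (p := fun i => nth i (l i) 0).
assert (pl : forall i n, i < length (l n) -> nth i (l n) 0 = p i).
{ intros i n Hi; unfold p.
  destruct (Nat.le_ge_cases i n) as [Hin|Hin].
  - destruct (lD i (n - i)) as [t Ht].
    replace (i + (n - i)) with n in Ht by lia.
    rewrite Ht, app_nth1; [reflexivity|rewrite lL; lia].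
  - destruct (lD n (i - n)) as [t Ht].
    replace (n + (i - n)) with i in Ht by lia.
    now rewrite Ht, app_nth1. }
exists p; split; [split|].
- intros i; rewrite <- (pl i (S i)), <- (pl (S i) (S i)) by (rewrite lL; lia).
  apply (lP (S i)); rewrite lL; lia.
- intros i j E.
  (* Both entries are read in the common prefix [l (i + j)], which has no repetition. *)
  rewrite <- (pl i (i + j)), <- (pl j (i + j)) in E by (rewrite lL; lia).
  revert E; apply NoDup_nth; try (rewrite lL; lia).
  apply (lP (i + j)).
- intros i Hi; rewrite <- (pl i 0) by (rewrite lL; lia).
  reflexivity.
Qed.

(** An infinite path prolonging [w] and [u] never returns to them, so its tail from [u] is an
    infinite part of the class; the converse is Koenig's lemma. *)
Lemma extendable_iff G w u :
  locally_finite G -> simple_path G (w ++ [u]) ->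
  extendable G (w ++ [u]) <->
  infinite_set (reach (beyond G (w ++ [u]) u) u).
Proof.
intros HL Hw; split.
- intros [_ (p & [Hp Hinj] & Ep)].
  rewrite length_app in Ep; simpl in Ep.
  set (n := length w) in *.
  assert (Eu : p n = u).
  { rewrite <- Ep by lia; unfold n.
    rewrite app_nth2, Nat.sub_diag by lia; reflexivity. }
  (* The word lists the values of [p] up to [n], so by injectivity only [k = 0] can occur. *)
  assert (Hin : forall k, In (p (n + k)) (w ++ [u]) -> p (n + k) = u).
  { intros k Hk; destruct (In_nth _ _ 0 Hk) as (i & Hi & Ei).
    rewrite length_app in Hi; simpl in Hi; fold n in Hi.
    rewrite Ep in Ei by lia; apply Hinj in Ei.
    replace (n + k) with n by lia; exact Eu. }
  apply (infinite_injection _ (fun k => p (n + k))).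
  + intros k; induction k as [|k IH].
    * rewrite Nat.add_0_r, Eu; apply rt_refl.
    * apply rt_trans with (p (n + k)); [exact IH|]; apply rt_step.
      split; [rewrite Nat.add_succ_r; apply Hp|split; apply Hin].
  + intros i j E; apply Hinj in E; lia.
- intros Hi; split; [exact Hw|].
  destruct (infinite_path_of_escaping G (rev (w ++ [u])) HL) as (p & Hp & Ep).
  + exists u, (rev w); split; [now rewrite rev_app_distr|].
    rewrite rev_involutive; split; [exact Hw|].
    revert Hi; apply infinite_mono; intros z; apply reach_mono.
    intros a b (H1 & H2 & H3); repeat split; trivial;
      now rewrite <- in_rev.
  + rewrite rev_involutive, length_rev in Ep; now exists p.
Qed.

(** * Separating sets of edges *)

(** Components are replaced by representatives. A point with an infinite class has a remaining edge,
    hence is a vertex of the graph after deletion. *)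
Lemma separates_iff G E :
  separates G E <->
  (forall e, In e E -> adj G (fst e) (snd e)) /\
  exists x y, infinite_set (reach (remaining G E) x) /\
    infinite_set (reach (remaining G E) y) /\ ~ reach (remaining G E) x y.
Proof.
unfold separates; rewrite Forall_forall; split; intros [HE H]; split; trivial.
- destruct H as (C & D & (x & _ & HC) & (y & _ & HD) & IC & ID & HN).
  exists x, y; repeat split.
  + revert IC; apply infinite_mono; intros z; apply HC.
  + revert ID; apply infinite_mono; intros z; apply HD.
  + intros Hxy; apply HN; intros v; rewrite HC, HD; split; intros Hv.
    * apply rt_trans with x; [|exact Hv].
      apply reach_sym; [apply remaining_sym|exact Hxy].
    * apply rt_trans with y; [exact Hxy|exact Hv].
- destruct H as (x & y & Hx & Hy & HN).
  exists (reach (remaining G E) x), (reach (remaining G E) y).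
  split; [|split; [|split; [exact Hx|split; [exact Hy|]]]].
  + exists x; split; [exact (infinite_reach_step _ _ Hx)|reflexivity].
  + exists y; split; [exact (infinite_reach_step _ _ Hy)|reflexivity].
  + intros HI; apply HN, HI, rt_refl.
Qed.

Lemma infinite_class_vert G (R : nat -> nat -> Prop) x :
  (forall a b, R a b -> adj G a b) -> infinite_set (reach R x) -> vert G x.
Proof.
intros HR Hx; destruct (infinite_reach_step _ _ Hx) as [y Hy].
apply adj_vert with y, HR, Hy.
Qed.

(* A vertex is joined to a given one, or to an endpoint of [E], without
   crossing [E]. *)
Lemma remaining_cover G E (P : nat -> Prop) u :
  connected G -> vert G u -> P u ->
  (forall e, In e E -> P (fst e) /\ P (snd e)) ->
  (forall a b, remaining G E a b -> P a -> P b) ->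
  forall v, vert G v -> P v.
Proof.
intros HG Hu HPu HE HP v Hv; generalize (HG u v Hu Hv).
revert v Hv; cut (forall v, joined G u v -> P v); [eauto|].
apply reach_ind; [exact HPu|].
intros x y _ Hx Hxy; destruct (classic (edge_mem x y E)) as [[H|H]|H].
- exact (proj2 (HE _ H)).
- exact (proj1 (HE _ H)).
- apply (HP x); [now split|exact Hx].
Qed.

(** The closed list is the class itself. Closure is stated over all neighbours in [G], the form in
    which the degree makes it verifiable. *)
Lemma finite_class_iff G (R : nat -> nat -> Prop) u :
  (forall a b, R a b -> adj G a b) -> vert G u ->
  ~ infinite_set (reach R u) <->
  exists L, In u L /\
    forall v, In v L -> vert G v /\ forall b, adj G v b -> In b L \/ ~ R v b.
Proof.
intros HR Hu; split.
- intros HF; destruct (not_infinite _ HF) as [M HM].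
  destruct (filter_prop (reach R u) M) as [L HL].
  exists L; split; [apply HL; split; [apply HM|]; apply rt_refl|].
  intros v Hv; apply HL in Hv; destruct Hv as [_ Hv]; split.
  + revert v Hv; apply reach_ind; [exact Hu|].
    intros x y _ _ Hxy; now apply adj_vert with x, adj_sym, HR.
  + intros b Hb; destruct (classic (R v b)) as [H|H]; [left|now right].
    assert (Hub : reach R u b) by (apply rt_trans with v; auto using rt_step).
    apply HL; auto.
- intros (L & HuL & HL) Hi; apply Hi; exists L.
  apply reach_ind; [exact HuL|].
  intros x y _ Hx Hxy; destruct (proj2 (HL x Hx) y (HR _ _ Hxy)); tauto.
Qed.

(** * Certificates that the class beyond a path is infinite *)

Lemma beyond_off G w u x : reach (beyond G w u) u x -> In x w -> x = u.
Proof.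
revert x; apply (reach_ind _ (fun x => In x w -> x = u)); [reflexivity|].
intros x y _ _ (_ & _ & Hy); exact Hy.
Qed.

(** Requiring each endpoint of [F] to be joined to [x] or [u] ensures, in a connected graph
    containing [u], that these are the only classes left by [F]. Infinity of the class of [x] is not
    requested: it follows from [separates]. *)
Definition separation_certificate (G : graph) (w : list nat) (u : nat) : Prop :=
  exists F x, separates G F /\ reach (beyond G w u) u x /\
    (forall e, In e F ->
       (reach (remaining G F) x (fst e) \/ reach (remaining G F) u (fst e)) /\
       (reach (remaining G F) x (snd e) \/ reach (remaining G F) u (snd e))) /\
    forall z, In z w -> reach (remaining G F) u z.

Definition cofinite_certificate (G : graph) (w : list nat) (u : nat) : Prop :=
  exists L, (forall z, In z w -> z = u \/ In z L) /\
    forall v, In v L -> vert G v /\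
      forall b, adj G v b -> In b L \/ reach (beyond G w u) u b.

(** An edge leaving the class of [u] enters [w], hence [L], and edges leaving [L] return to the
    class. By connectedness the two exhaust the vertices, so a finite class would make the graph
    finite. *)
Lemma cofinite_certificate_sound G w u :
  connected G -> infinite_graph G -> vert G u ->
  cofinite_certificate G w u -> infinite_set (reach (beyond G w u) u).
Proof.
intros HG HI Hu (L & Hw & HL) [M HM]; apply HI; exists (L ++ M).
assert (H : forall v, joined G u v -> In v L \/ reach (beyond G w u) u v).
{ apply reach_ind; [right; apply rt_refl|].
  intros x y _ [Hx|Hx] Hxy; [now apply (HL x)|].
  destruct (classic (In y w)) as [Hy|Hy].
  - destruct (Hw y Hy) as [->|Hy']; [right; apply rt_refl|now left].
  - right; apply rt_trans with x; [exact Hx|]; apply rt_step.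
    split; [exact Hxy|split; [now apply beyond_off with G|contradiction]]. }
intros v Hv; apply in_or_app; destruct (H v (HG u v Hu Hv)); auto.
Qed.

(** Two distinct infinite classes exist and only those of [x] and [u] are available, so the class of
    [x] is infinite and misses [w]; it is then contained in the class beyond [w], which contains
    [x]. *)
Lemma separation_certificate_sound G w u :
  connected G -> vert G u -> separation_certificate G w u ->
  infinite_set (reach (beyond G w u) u).
Proof.
intros HG Hu (F & x & HF & Hux & HE & Hw).
apply separates_iff in HF; destruct HF as (_ & a & b & Ha & Hb & HN).
assert (sym := fun p q => reach_sym _ p q (remaining_sym G F)).
assert (HC : forall v, vert G v ->
  reach (remaining G F) x v \/ reach (remaining G F) u v).
{ apply (remaining_cover G F _ u HG Hu); [right; apply rt_refl|exact HE|].
  intros p q Hpq [Hp|Hp]; [left|right];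
    (apply rt_trans with p; [exact Hp|now apply rt_step]). }
assert (Hax := HC a (infinite_class_vert G _ a (fun p q H => proj1 H) Ha)).
assert (Hbx := HC b (infinite_class_vert G _ b (fun p q H => proj1 H) Hb)).
assert (Hi : infinite_set (reach (remaining G F) x) /\
             ~ reach (remaining G F) x u).
(* The separated points [a] and [b] cannot lie in the same class, so one is with [x] and the other
   with [u]. *)
{ destruct Hax as [Hax|Hau], Hbx as [Hbx|Hbu].
  - exfalso; apply HN; apply rt_trans with x; auto.
  - split.
    + revert Ha; apply infinite_mono; intros z Hz; now apply rt_trans with a.
    + intros Hxu; apply HN; apply rt_trans with x; [now apply sym|].
      now apply rt_trans with u.
  - split.
    + revert Hb; apply infinite_mono; intros z Hz; now apply rt_trans with b.
    + intros Hxu; apply HN; apply rt_trans with u; [now apply sym|].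
      apply rt_trans with x; [now apply sym|exact Hbx].
  - exfalso; apply HN; apply rt_trans with u; auto. }
destruct Hi as [Hi Hxu].
assert (Hoff : forall z, reach (remaining G F) x z -> ~ In z w).
{ intros z Hz Hzw; apply Hxu; apply rt_trans with z; auto. }
revert Hi; apply infinite_mono; intros z Hz.
apply rt_trans with x; [exact Hux|]; revert Hz; apply reach_sub.
intros p q Hp Hpq; split; [apply Hpq|].
split; intros H; exfalso; revert H; apply Hoff; trivial.
apply rt_trans with p; auto using rt_step.
Qed.

Lemma path_joined G w z z' (R : nat -> nat -> Prop) :
  (forall a b, R a b -> R b a) ->
  (forall a b, In a w -> In b w -> adj G a b -> R a b) ->
  is_path G w -> In z w -> In z' w -> reach R z z'.
Proof.
intros HS HR (_ & _ & Hw) Hz Hz'.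
assert (H : forall i, i < length w -> reach R (nth 0 w 0) (nth i w 0)).
{ intros i; induction i as [|i IH]; intros Hi; [apply rt_refl|].
  apply rt_trans with (nth i w 0); [apply IH; lia|].
  apply rt_step, HR; [apply nth_In; lia|apply nth_In; lia|apply Hw; lia]. }
destruct (In_nth _ _ 0 Hz) as (i & Hi & <-).
destruct (In_nth _ _ 0 Hz') as (j & Hj & <-).
apply rt_trans with (nth 0 w 0); [apply reach_sym|]; auto.
Qed.

(* Let [T] be [w] together with its neighbours and let [C] be an infinite class
   outside [T]. The complement of [C] is joined through [T], so the edges
   between [T] and [C] leave exactly two components. *)
Lemma separation_certificate_complete G w u :
  connected G -> locally_finite G -> is_path G w -> In u w ->
  infinite_set (reach (beyond G w u) u) ->
  infinite_set (fun v => vert G v /\ ~ reach (beyond G w u) u v) ->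
  separation_certificate G w u.
Proof.
intros HG HL Hw Hu Hi HI.
destruct (neighbours_list G w HL) as [N HN].
(* [N] may contain other numbers as well, so it is cut down to actual neighbours of [w]. *)
destruct (filter_prop (fun t => exists s, In s w /\ adj G s t) N) as [N' HN'].
set (T := w ++ N').
assert (HT : forall t, In t T <-> In t w \/ exists s, In s w /\ adj G s t).
{ intros t; unfold T; rewrite in_app_iff, HN'; split.
  - intros [H|[_ H]]; auto.
  - intros [H|(s & H1 & H2)]; [now left|right; split; eauto]. }
destruct (infinite_class_outside G _ T u HL (fun a b H => proj1 H)
  (proj2 (HT u) (or_introl Hu)) Hi) as (_ & c & _ & _ & Huc & HcT & Hci).
set (C := reach (outside (beyond G w u) T) c) in *.
assert (CT : forall z, C z -> ~ In z T).
{ apply (reach_ind _ (fun z => ~ In z T)); [exact HcT|].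
  intros x y _ _ (_ & _ & Hy); exact Hy. }
assert (CU : forall z, C z -> reach (beyond G w u) u z).
{ intros z Hz; apply rt_trans with c; [exact Huc|].
  revert Hz; apply reach_mono; now intros x y [H _]. }
assert (CS : forall z z', C z -> adj G z z' -> ~ In z' T -> C z').
{ intros z z' Hz Hzz' Hz'; apply rt_trans with z; [exact Hz|].
  apply rt_step; split; [|split; [now apply CT|exact Hz']].
  split; [exact Hzz'|split; intros H; exfalso].
  - apply (CT z Hz), HT; now left.
  - apply Hz', HT; now left. }
destruct (neighbours_list G T HL) as [M HM].
destruct (filter_prop (fun e => adj G (fst e) (snd e) /\ C (snd e))
  (list_prod T M)) as [F HF0].
(* Each deleted edge is listed with its end in [T] first and its end in [C] second. *)
assert (HF : forall a b, In (a, b) F <-> In a T /\ C b /\ adj G a b).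
{ intros a b; rewrite HF0, in_prod_iff; simpl; split.
  - tauto.
  - intros (H1 & H2 & H3); repeat split; eauto. }
clear HF0.
assert (uT : In u T) by (apply HT; now left).
assert (sym := remaining_sym G F).
assert (out : forall a b, ~ C a -> ~ C b -> adj G a b -> remaining G F a b).
{ intros a b Ha Hb Hab; split; [exact Hab|].
  intros [H|H]; apply HF in H; tauto. }
assert (TC : forall t, In t T -> ~ C t) by (intros t Ht HC; now apply (CT t)).
assert (wu : forall z, In z w -> reach (remaining G F) u z).
{ intros z Hz; apply (path_joined G w); trivial.
  intros a b Ha Hb; apply out; apply TC, HT; now left. }
(* Every point of [T] is on [w] or next to it, and edges inside [T] are not deleted. *)
assert (Tu : forall t, In t T -> reach (remaining G F) u t).
{ intros t Ht; assert (Ht' := Ht); apply HT in Ht'.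
  destruct Ht' as [Ht'|(s & Hs & Hst)]; [now apply wu|].
  apply rt_trans with s; [now apply wu|].
  apply rt_step, out; trivial; [apply TC, HT; now left|now apply TC]. }
assert (cC : forall z, C z -> reach (remaining G F) c z).
{ intros z; apply reach_sub.
  intros x y Hx (Hxy & HxT & HyT); split; [apply Hxy|].
  intros [H|H]; apply HF in H; tauto. }
assert (Cc : forall z, reach (remaining G F) c z -> C z).
{ apply reach_ind; [apply rt_refl|].
  intros x y _ Hx [Hxy HxyF]; apply (CS x); trivial.
  intros HyT; apply HxyF; right; apply HF; repeat split; trivial.
  now apply adj_sym. }
assert (Vu : vert G u).
{ destruct Hw as (_ & Hv & _); rewrite Forall_forall in Hv; now apply Hv. }
assert (cover : forall v, vert G v -> C v \/ reach (remaining G F) u v).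
{ intros v Hv; generalize (HG u v Vu Hv); clear Hv; revert v.
  apply reach_ind; [right; apply rt_refl|].
  intros x y _ Hx Hxy.
  destruct (classic (In y T)) as [HyT|HyT]; [right; now apply Tu|].
  destruct (classic (C y)) as [HyC|HyC]; [now left|right].
  destruct (classic (C x)) as [HxC|HxC].
  - exfalso; apply HyC; now apply (CS x).
  - destruct Hx as [Hx|Hx]; [contradiction|].
    apply rt_trans with x; [exact Hx|]; now apply rt_step, out. }
exists F, c; split; [apply separates_iff; split|split; [exact Huc|split]]; trivial.
- intros [a b] H; apply HF in H; apply H.
- exists c, u; split; [|split].
  + revert Hci; now apply infinite_mono.
  (* [C] lies in the class beyond [w], so the infinitely many vertices off that class are all joined
     to [u]. *)
  + revert HI; apply infinite_mono; intros v [Hv Hvu].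
    destruct (cover v Hv) as [H|H]; [exfalso; auto|exact H].
  + intros H; apply Cc in H; now apply (TC u).
- intros [a b] H; apply HF in H; destruct H as (H1 & H2 & _); simpl.
  split; [right; auto|left; auto].
Qed.

Lemma infinite_beyond_iff G w u :
  connected G -> infinite_graph G -> locally_finite G -> is_path G w -> In u w ->
  infinite_set (reach (beyond G w u) u) <->
  separation_certificate G w u \/ cofinite_certificate G w u.
Proof.
intros HG HI HL Hw Hu.
assert (Vu : vert G u).
{ destruct Hw as (_ & Hv & _); rewrite Forall_forall in Hv; now apply Hv. }
split.
- intros Hi.
  destruct (classic (infinite_set
    (fun v => vert G v /\ ~ reach (beyond G w u) u v))) as [HV|HV].
  + left; now apply separation_certificate_complete.
  + right; apply not_infinite in HV; destruct HV as [M HM].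
    destruct (filter_prop (fun v => vert G v /\ ~ reach (beyond G w u) u v) M)
      as [L HL'].
    assert (HL'' : forall v, vert G v -> In v L \/ reach (beyond G w u) u v).
    { intros v Hv; destruct (classic (reach (beyond G w u) u v)) as [H|H];
        [now right|left; apply HL'; auto]. }
    exists L; split.
    * intros z Hz; destruct Hw as (_ & Hv & _); rewrite Forall_forall in Hv.
      destruct (HL'' z (Hv z Hz)) as [H|H]; [now right|left].
      now apply beyond_off with G w.
    * intros v Hv; apply HL' in Hv; destruct Hv as (_ & Hv & _).
      split; [exact Hv|]; intros b Hb; apply HL''.
      now apply adj_vert with v, adj_sym.
- intros [H|H];
    [now apply separation_certificate_sound|now apply cofinite_certificate_sound].
Qed.

(** * Trees *)

Lemma chain_app (R : nat -> nat -> Prop) l l' : chain R (l ++ l') -> chain R l'.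
Proof. induction l as [|x l IH]; [easy|]; intros [_ H]; exact (IH H). Qed.

Lemma chain_nth (R : nat -> nat -> Prop) l :
  chain R l -> forall i, S i < length l -> R (nth i l 0) (nth (S i) l 0).
Proof.
induction l as [|x l IH]; simpl; intros Hl i Hi; [lia|].
destruct Hl as [Hx Hl]; destruct i as [|i].
- destruct Hx as [->|(z & s & -> & Hz)]; [simpl in Hi; lia|exact Hz].
- apply IH; [exact Hl|lia].
Qed.

Lemma last_app_cons {X} (l l' : list X) x d :
  last (l ++ x :: l') d = last (x :: l') d.
Proof.
induction l as [|y l IH]; [reflexivity|].
rewrite <- IH; simpl; destruct (l ++ x :: l') eqn:E; [|reflexivity].
now apply app_eq_nil in E.
Qed.

(** Loop erasure: if the new first vertex recurs later, the walk is restarted from that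
    occurrence. *)
Lemma reach_simple (R : nat -> nat -> Prop) a b :
  reach R a b -> exists s, NoDup (a :: s) /\ chain R (a :: s) /\ last (a :: s) 0 = b.
Proof.
intros H; apply clos_rt_rt1n in H; induction H as [a|a c b Hac _ IH].
- exists []; repeat split; [now repeat constructor|now left].
- destruct IH as (s & Hs & Hc & Hl).
  destruct (classic (In a (c :: s))) as [Ha|Ha].
  + apply in_split in Ha; destruct Ha as (l1 & l2 & E).
    rewrite E in Hs, Hc, Hl; exists l2; split; [|split].
    * now apply NoDup_app_remove_l in Hs.
    * now apply chain_app in Hc.
    * now rewrite last_app_cons in Hl.
  + exists (c :: s); split; [now constructor|]; split; [|exact Hl].
    split; [right; now exists c, s|exact Hc].
Qed.

(** A simple walk joining the ends of an edge without using it closes up to a cycle. *)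
Lemma tree_edge_separates G a b :
  tree G -> adj G a b -> ~ reach (remaining G [(a, b)]) a b.
Proof.
intros [_ HT] Hab Hr; destruct (reach_simple _ _ _ Hr) as (s & Hs & Hc & Hl).
(* One vertex would give a loop, two would use the deleted edge, and three or more form a cycle. *)
destruct s as [|c [|d s]].
- simpl in Hl; subst b; now apply (adj_irrefl G a).
- simpl in Hl; subst c.
  destruct Hc as [[E|(z & t & E & [_ Hz])] _]; [discriminate|].
  injection E as <- <-; apply Hz; left; now left.
- assert (Hn := chain_nth _ _ Hc); set (w := a :: c :: d :: s) in *.
  apply (HT w); repeat split; trivial.
  + discriminate.
  + apply Forall_forall; intros x Hx.
    destruct (In_nth _ _ 0 Hx) as (i & Hi & <-).
    destruct (Nat.eq_dec (S i) (length w)) as [E|E].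
    * destruct i as [|i]; [discriminate|].
      apply adj_vert with (nth i w 0), adj_sym, Hn; lia.
    * apply adj_vert with (nth (S i) w 0), Hn; lia.
  + intros i Hi; now apply Hn.
  + simpl; lia.
  + rewrite Hl; now apply adj_sym.
Qed.

(** * Edges leading away from a finite set of edges *)

Definition inside (G : graph) (T : list nat) (a b : nat) : Prop :=
  adj G a b /\ In a T /\ In b T.

(** The union of walks from [r] to the points of [l]; it serves to enclose the endpoints of [E] in a
    finite connected set. *)
Lemma finite_connected_superset G r l :
  (forall x, In x l -> joined G r x) ->
  exists T, In r T /\ incl l T /\ forall t, In t T -> reach (inside G T) r t.
Proof.
assert (mono : forall T T' t, incl T T' ->
  reach (inside G T) r t -> reach (inside G T') r t).
{ intros T T' t HT; apply reach_mono; intros a b (H1 & H2 & H3).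
  repeat split; auto. }
assert (single : forall x, joined G r x ->
  exists T, In r T /\ In x T /\ forall t, In t T -> reach (inside G T) r t).
{ apply reach_ind.
  - exists [r]; repeat split; try now left.
    intros t [<-|[]]; apply rt_refl.
  - intros x y _ (T & H1 & H2 & H3) Hxy; exists (y :: T).
    assert (HI : incl T (y :: T)) by (intros t Ht; now right).
    repeat split; [now right|now left|].
    intros t [<-|Ht].
    + apply rt_trans with x; [apply (mono T); auto|].
      apply rt_step; repeat split; [exact Hxy|now right|now left].
    + apply (mono T); auto. }
induction l as [|x l IH]; intros Hl.
- exists [r]; repeat split; [now left|easy|].
  intros t [<-|[]]; apply rt_refl.
- destruct IH as (T & H1 & H2 & H3); [intros; apply Hl; now right|].
  destruct (single x) as (T' & H1' & H2' & H3'); [apply Hl; now left|].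
  exists (T ++ T'); repeat split.
  + apply in_or_app; auto.
  + intros y [<-|Hy]; apply in_or_app; auto.
  + intros t Ht; apply in_app_iff in Ht; destruct Ht as [Ht|Ht].
    * apply (mono T); [apply incl_appl, incl_refl|auto].
    * apply (mono T'); [apply incl_appr, incl_refl|auto].
Qed.

Lemma simple_path_edge G x y : adj G x y -> simple_path G [x; y].
Proof.
intros H; repeat split; [discriminate| | |].
- repeat constructor; [now apply adj_vert with y|].
  now apply adj_vert with x, adj_sym.
- intros [|i] Hi; [exact H|simpl in Hi; lia].
- repeat constructor; [|easy].
  intros [->|[]]; now apply (adj_irrefl G x).
Qed.

Lemma extendable_edge G x y : extendable G [x; y] -> adj G x y.
Proof. intros [[(_ & _ & H) _] _]; apply (H 0); simpl; lia. Qed.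

(** All of [E] is on the side of [x], while an infinite path starts with [x] and [y]; in a tree the
    side of [y] is thus infinite and untouched by [E]. *)
Definition end_edge (G : graph) (E : list (nat * nat)) (x y : nat) : Prop :=
  extendable G [x; y] /\
  forall e, In e E -> reach (remaining G [(x, y)]) x (fst e) /\
                      reach (remaining G [(x, y)]) x (snd e).

(** Enclose [c] and the endpoints of [E] in a finite connected set [T] and take an edge by which the
    class of [c] leaves [T] towards an infinite class outside [T]. *)
Lemma end_edge_exists G E c :
  connected G -> locally_finite G ->
  (forall e, In e E -> adj G (fst e) (snd e)) ->
  infinite_set (reach (remaining G E) c) ->
  exists x y, end_edge G E x y /\ reach (remaining G E) c x.
Proof.
intros HG HL HE Hc.
assert (Vc := infinite_class_vert G _ c (fun a b H => proj1 H) Hc).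
destruct (finite_connected_superset G c (map fst E ++ map snd E))
  as (T & cT & ET & HT).
{ intros x Hx; apply HG; [exact Vc|].
  apply in_app_iff in Hx; destruct Hx as [Hx|Hx];
    apply in_map_iff in Hx; destruct Hx as (e & <- & He).
  - apply adj_vert with (snd e); auto.
  - apply adj_vert with (fst e), adj_sym; auto. }
destruct (infinite_class_outside G _ T c HL (fun a b H => proj1 H) cT Hc)
  as (x & y & xT & Hxy & Hcy & yT & Hi).
exists x, y; split; [split|].
- apply (extendable_iff G [x] y HL); [apply simple_path_edge, Hxy|].
  revert Hi; apply infinite_mono; intros z; apply reach_mono.
  intros a b ([Hab _] & Ha & Hb); split; [exact Hab|].
  split; intros [->|[->|[]]]; trivial; contradiction.
(* [y] is not in [T], so the walks inside [T] survive the deletion of the edge [(x, y)]. *)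
- assert (Hx : forall t, In t T -> reach (remaining G [(x, y)]) x t).
  { assert (H : forall t, In t T -> reach (remaining G [(x, y)]) c t).
    { intros t Ht; generalize (HT t Ht); apply reach_mono.
      intros a b (Hab & Ha & Hb); split; [exact Hab|].
      intros [[H|[]]|[H|[]]]; injection H as -> ->; contradiction. }
    intros t Ht; apply rt_trans with c; [|now apply H].
    apply reach_sym; [apply remaining_sym|now apply H]. }
  intros e He; split; apply Hx, ET, in_or_app; [left|right]; now apply in_map.
- apply rt_trans with y; [exact Hcy|]; now apply rt_step, remaining_sym.
Qed.

Lemma end_edge_infinite G E x y :
  tree G -> locally_finite G -> end_edge G E x y ->
  infinite_set (reach (remaining G E) y).
Proof.
intros HT HL [Hxy HE].
assert (Hadj := extendable_edge G x y Hxy).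
apply (extendable_iff G [x] y HL) in Hxy; [|now apply simple_path_edge].
revert Hxy; apply infinite_mono; intros z Hz.
assert (sym := fun a b => reach_sym _ a b (remaining_sym G [(x, y)])).
assert (Hoff : forall a, reach (remaining G [(x, y)]) x a ->
                         ~ reach (remaining G [(x, y)]) y a).
{ intros a Hxa Hya; apply (tree_edge_separates G x y HT Hadj).
  apply rt_trans with a; auto. }
assert (Hz' : reach (remaining G [(x, y)]) y z).
{ revert Hz; apply reach_mono; intros a b (Hab & Ha & Hb).
  split; [exact Hab|].
  assert (xy : x = y -> False) by (intros ->; now apply (adj_irrefl G y)).
  intros [[H|[]]|[H|[]]]; injection H as -> ->; apply xy.
  - apply Ha; now left.
  - apply Hb; now left. }
revert Hz'; apply reach_sub; intros a b Ha Hab; split; [apply Hab|].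
(* An edge of [E] met on the side of [y] would have an endpoint on both sides of [(x, y)]. *)
intros [H|H]; apply (Hoff a); trivial; apply HE in H; apply H.
Qed.

Definition edge_certificate (G : graph) (E : list (nat * nat)) : Prop :=
  exists x y x' y' a b, end_edge G E x y /\ end_edge G E x' y' /\
    edge_mem a b E /\ reach (remaining G [(a, b)]) x a /\
    reach (remaining G [(a, b)]) x' b.

Lemma remaining_incl G E E' a b :
  incl E E' -> remaining G E' a b -> remaining G E a b.
Proof.
intros HE [H1 H2]; split; [exact H1|]; intros [H|H]; apply H2;
  [left|right]; auto.
Qed.

(** If [y] and [y'] were joined off [E], then going from [a] through [x], [y], [y'], [x'] to [b]
    would avoid the edge [(a, b)], which is impossible in a tree. *)
Lemma edge_certificate_sound G E :
  tree G -> locally_finite G -> (forall e, In e E -> adj G (fst e) (snd e)) ->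
  edge_certificate G E -> separates G E.
Proof.
intros HT HL HE (x & y & x' & y' & a & b & Hxy & Hxy' & Hab & Hxa & Hxb).
apply separates_iff; split; [exact HE|].
exists y, y'; repeat split;
  [now apply end_edge_infinite with x|now apply end_edge_infinite with x'|].
intros Hyy.
assert (Gab : adj G a b)
  by (destruct Hab as [H|H]; apply HE in H; [|apply adj_sym]; exact H).
(* An end edge is not [(a, b)] in either direction: otherwise [y] would be an endpoint of [E] and
   lie on the side of [x]. *)
assert (cross : forall x y, end_edge G E x y -> remaining G [(a, b)] x y).
{ clear - HT HE Hab Gab; intros x y [Hxy Hx].
  assert (Hadj := extendable_edge G x y Hxy); split; [exact Hadj|].
  intros H; assert (HyE : exists z, In (z, y) E \/ In (y, z) E).
  { destruct H as [[H|[]]|[H|[]]]; injection H as -> ->;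
      [exists x; exact Hab|exists x; destruct Hab as [Hab|Hab]; auto]. }
  apply (tree_edge_separates G x y HT Hadj).
  destruct HyE as [z [Hz|Hz]]; apply Hx in Hz; apply Hz. }
assert (sym := fun p q => reach_sym _ p q (remaining_sym G [(a, b)])).
apply (tree_edge_separates G a b HT Gab).
apply rt_trans with x; [now apply sym|].
apply rt_trans with y; [now apply rt_step, cross|].
apply rt_trans with y'.
- revert Hyy; apply reach_mono; intros p q [Hpq HpqE]; split; [exact Hpq|].
  unfold edge_mem in *.
  intros [[H|[]]|[H|[]]]; injection H as -> ->; tauto.
- apply rt_trans with x'; [apply rt_step, remaining_sym; now apply cross|exact Hxb].
Qed.

(** Putting back one edge can only merge the class of [a] with that of [b]. *)
Lemma reach_delete_edge G E a b x z :
  reach (remaining G E) x z ->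
  reach (remaining G ((a, b) :: E)) x z \/
  (reach (remaining G ((a, b) :: E)) x a /\ reach (remaining G ((a, b) :: E)) b z) \/
  (reach (remaining G ((a, b) :: E)) x b /\ reach (remaining G ((a, b) :: E)) a z).
Proof.
set (R := remaining G ((a, b) :: E)); revert z.
apply reach_ind; [left; apply rt_refl|].
intros z z' _ Hz [Hzz HzE].
destruct (classic (edge_mem z z' [(a, b)])) as [Hm|Hm].
- destruct Hm as [[H|[]]|[H|[]]]; injection H as -> ->.
  + destruct Hz as [H|[[H1 H2]|[H1 H2]]].
    * right; left; split; [exact H|apply rt_refl].
    * right; left; split; [exact H1|apply rt_refl].
    * now left.
  + destruct Hz as [H|[[H1 H2]|[H1 H2]]].
    * right; right; split; [exact H|apply rt_refl].
    * now left.
    * right; right; split; [exact H1|apply rt_refl].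
- assert (HR : R z z').
  { split; [exact Hzz|]; unfold edge_mem in *; simpl in *; tauto. }
  destruct Hz as [H|[[H1 H2]|[H1 H2]]]; [left|right; left|right; right];
    try split; trivial; apply rt_trans with z; auto using rt_step.
Qed.

(** Delete the edges one at a time: at the deletion that disconnects [x] from [z], these points are
    joined to opposite ends of the edge, and remain so when no other edge is deleted. *)
Lemma separating_edge G E x z :
  reach (remaining G []) x z -> ~ reach (remaining G E) x z ->
  exists a b, edge_mem a b E /\ reach (remaining G [(a, b)]) x a /\
    reach (remaining G [(a, b)]) z b.
Proof.
intros Hxz; induction E as [|[a b] E IH]; intros HN; [contradiction|].
destruct (classic (reach (remaining G E) x z)) as [H|H].
- assert (mono : forall p q, reach (remaining G ((a, b) :: E)) p q ->
                   reach (remaining G [(a, b)]) p q).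
  { intros p q; apply reach_mono; intros s t; apply remaining_incl.
    intros e [<-|[]]; now left. }
  assert (sym := fun p q => reach_sym _ p q (remaining_sym G [(a, b)])).
  destruct (reach_delete_edge G E a b x z H) as [H'|[[H1 H2]|[H1 H2]]].
  + contradiction.
  + exists a, b; split; [left; now left|auto].
  + assert (flip : forall p q, reach (remaining G [(a, b)]) p q ->
                     reach (remaining G [(b, a)]) p q).
    { intros p q; apply reach_mono; intros s t [Hst Hm]; split; [exact Hst|].
      intros [[E'|[]]|[E'|[]]]; injection E' as -> ->; apply Hm;
        [right|left]; now left. }
    exists b, a; split; [right; now left|auto].
- destruct (IH H) as (a' & b' & [Hm|Hm] & H1 & H2); exists a', b';
    (split; [|now split]); [left|right]; now right.
Qed.

(** Each of the two infinite classes supplies an end edge starting inside it; [E] disconnects these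
    two starting points, so one of its edges lies between them. *)
Lemma edge_certificate_complete G E :
  connected G -> locally_finite G -> separates G E -> edge_certificate G E.
Proof.
intros HG HL HS; apply separates_iff in HS.
destruct HS as (HE & c & d & Hc & Hd & HN).
destruct (end_edge_exists G E c HG HL HE Hc) as (x & y & Hxy & Hcx).
destruct (end_edge_exists G E d HG HL HE Hd) as (x' & y' & Hxy' & Hdx').
assert (Vx : forall x y, end_edge G E x y -> vert G x).
{ intros p q [Hpq _]; apply adj_vert with q, extendable_edge, Hpq. }
destruct (separating_edge G E x x') as (a & b & H1 & H2 & H3).
- generalize (HG x x' (Vx _ _ Hxy) (Vx _ _ Hxy')); apply reach_mono.
  intros p q Hpq; split; [exact Hpq|now intros [[]|[]]].
- intros H; apply HN; apply rt_trans with x; [exact Hcx|].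
  apply rt_trans with x'; [exact H|].
  apply reach_sym; [apply remaining_sym|exact Hdx'].
- exists x, y, x', y', a, b; repeat split; trivial; apply Hxy || apply Hxy'; trivial.
Qed.

Definition unseparated_certificate (G : graph) (E : list (nat * nat)) : Prop :=
  exists u, vert G u /\ forall e, In e E ->
    (reach (remaining G E) u (fst e) \/
     ~ infinite_set (reach (remaining G E) (fst e))) /\
    (reach (remaining G E) u (snd e) \/
     ~ infinite_set (reach (remaining G E) (snd e))).

(** By [remaining_cover] the condition on the endpoints of [E] spreads to all vertices, so every
    infinite class is that of [u]. *)
Lemma not_separates_iff G E :
  connected G -> infinite_graph G ->
  (forall e, In e E -> adj G (fst e) (snd e)) ->
  ~ separates G E <-> unseparated_certificate G E.
Proof.
intros HG HI HE; rewrite separates_iff; split.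
- intros HN.
  assert (H : exists u, vert G u /\ forall v,
    reach (remaining G E) u v \/ ~ infinite_set (reach (remaining G E) v)).
  { destruct (classic (exists u, infinite_set (reach (remaining G E) u)))
      as [[u Hu]|HF].
    - exists u; split;
        [exact (infinite_class_vert G _ u (fun a b H => proj1 H) Hu)|].
      intros v; apply NNPP; intros Hv; apply HN; split; [exact HE|].
      exists u, v; tauto.
    (* With no infinite class at all any vertex serves, and an infinite graph has one. *)
    - destruct (classic (exists u, vert G u)) as [[u Hu]|HV].
      + exists u; split; [exact Hu|]; intros v; right; intros Hv.
        apply HF; now exists v.
      + exfalso; apply HI; exists []; intros v Hv; apply HV; now exists v. }
  destruct H as (u & Hu & H); exists u; split; [exact Hu|auto].
- intros (u & Hu & HC) (_ & x & y & Hx & Hy & HN).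
  assert (sym := fun p q => reach_sym _ p q (remaining_sym G E)).
  assert (H : forall v, vert G v ->
    reach (remaining G E) u v \/ ~ infinite_set (reach (remaining G E) v)).
  { apply (remaining_cover G E _ u HG Hu); [left; apply rt_refl|exact HC|].
    intros a b Hab [Ha|Ha]; [left|right].
    - apply rt_trans with a; auto using rt_step.
    - contradict Ha; revert Ha; apply infinite_mono.
      intros z Hz; apply rt_trans with b; auto using rt_step. }
  assert (Vx := infinite_class_vert G _ x (fun a b H => proj1 H) Hx).
  assert (Vy := infinite_class_vert G _ y (fun a b H => proj1 H) Hy).
  destruct (H x Vx) as [Hux|Hux]; [|contradiction].
  destruct (H y Vy) as [Huy|Huy]; [|contradiction].
  apply HN; apply rt_trans with u; auto.
Qed.

(** * The reductions *)

Ltac comp_tac :=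
  repeat first
    [ exact comp_id | refine (comp_fst _ _) | refine (comp_snd _ _)
    | refine (comp_pair _ _ _ _) | refine (comp_cons _ _ _ _)
    | refine (comp_skipn _ _ _ _) | refine (comp_const _) ].

(** Follows the shape of the formula and stops at the relations treated by the lemmas below.
    [ce_forall_neighbours] precedes [ce_and], since its formula is itself a conjunction. *)
Ltac ce_tac :=
  cbv beta;
  lazymatch goal with
  | |- comp _ => comp_tac
  | |- ce _ _ (fun _ _ => remaining _ _ _ _) => idtac
  | |- ce _ _ (fun _ _ => beyond _ _ _ _ _) => idtac
  | |- ce _ _ (fun _ _ => separates _ _) => idtac
  | |- ce _ _ (fun _ _ => extendable _ _) => idtac
  | |- ce _ _ _ =>
      first
        [ refine (ce_forall_neighbours _ _ _ _ _ _); ce_tac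
        | refine (ce_and _ _ _ _ _ _); ce_tac
        | refine (ce_or _ _ _ _ _ _); ce_tac
        | refine (ce_ex _ _ _ _); ce_tac
        | refine (ce_eq _ _ _ _ _ _); ce_tac
        | refine (ce_neq _ _ _ _ _ _); ce_tac
        | refine (ce_adj _ _ _ _ _ _); ce_tac
        | refine (ce_not_adj _ _ _ _ _ _); ce_tac
        | refine (ce_vert _ _ _ _); ce_tac
        | refine (ce_not_vert _ _ _ _); ce_tac
        | refine (ce_in _ _ _ _ _ _); ce_tac
        | refine (ce_not_in _ _ _ _ _ _); ce_tac
        | refine (ce_forall_in _ _ _ _ _ _); ce_tac
        | refine (ce_reach _ _ _ _ _ _ _ _); ce_tac
        | idtac ]
  end.

Lemma ce_remaining K B {X} `{coded X} E (f g : X -> nat) :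
  comp E -> comp f -> comp g ->
  ce K B (fun G x => remaining G (E x) (f x) (g x)).
Proof.
intros HE Hf Hg.
apply (ce_ext _ _ (fun G x =>
  adj G (f x) (g x) /\ ~ In (f x, g x) (E x) /\ ~ In (g x, f x) (E x))).
- intros G x _ _; unfold remaining, edge_mem; tauto.
- ce_tac; trivial. 
Qed.

Lemma ce_not_remaining K B {X} `{coded X} E (f g : X -> nat) :
  comp E -> comp f -> comp g ->
  ce K B (fun G x => ~ remaining G (E x) (f x) (g x)).
Proof.
intros HE Hf Hg.
apply (ce_ext _ _ (fun G x =>
  ~ adj G (f x) (g x) \/ In (f x, g x) (E x) \/ In (g x, f x) (E x))).
- intros G x _ _; unfold remaining, edge_mem.
  destruct (classic (adj G (f x) (g x))); tauto.
- ce_tac; trivial.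
Qed.

(** Implication is not among the closure properties, so it is rewritten classically as a disjunction
    with non-membership. *)
Lemma ce_beyond K B {X} `{coded X} w (u f g : X -> nat) :
  comp w -> comp u -> comp f -> comp g ->
  ce K B (fun G x => beyond G (w x) (u x) (f x) (g x)).
Proof.
intros Hw Hu Hf Hg.
apply (ce_ext _ _ (fun G x =>
  adj G (f x) (g x) /\ (~ In (f x) (w x) \/ f x = u x) /\
  (~ In (g x) (w x) \/ g x = u x))).
- intros G x _ _; unfold beyond.
  destruct (classic (In (f x) (w x))), (classic (In (g x) (w x))); tauto.
- ce_tac; trivial.
Qed.

Lemma ce_not_beyond K B {X} `{coded X} w (u f g : X -> nat) :
  comp w -> comp u -> comp f -> comp g ->
  ce K B (fun G x => ~ beyond G (w x) (u x) (f x) (g x)).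
Proof.
intros Hw Hu Hf Hg.
apply (ce_ext _ _ (fun G x =>
  ~ adj G (f x) (g x) \/ (In (f x) (w x) /\ f x <> u x) \/
  (In (g x) (w x) /\ g x <> u x))).
- intros G x _ _; unfold beyond.
  destruct (classic (adj G (f x) (g x))), (classic (In (f x) (w x))),
    (classic (In (g x) (w x))); tauto.
- ce_tac; trivial.
Qed.

(** Checking that a list is closed only involves the negation of [R], so it is the complement of [R]
    that has to be enumerable. *)
Lemma ce_finite_class K B {X} `{coded X} (R : graph -> X -> nat -> nat -> Prop)
    (u : X -> nat) :
  (forall G x a b, R G x a b -> adj G a b) -> comp u ->
  ce K B (fun G p => ~ R G (fst (fst p)) (snd (fst p)) (snd p)) ->
  ce K B (fun G x => vert G (u x) /\ ~ infinite_set (reach (R G x) (u x))).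
Proof.
intros HR Hu HN.
apply (ce_ext _ _ (fun G x => vert G (u x) /\ exists L, In (u x) L /\
  forall v, In v L -> vert G v /\
    forall b, adj G v b -> In b L \/ ~ R G x v b)).
- intros G x _ _; split; intros [Hx HF]; (split; [exact Hx|]);
    now apply (finite_class_iff G _ _ (HR G x)).
- ce_tac; trivial.
  + apply (comp_comp u (fun p : X * list nat => fst p) Hu); comp_tac.
  + apply (ce_comp _ _ (fun p : X * list nat * nat * nat =>
      (fst (fst (fst p)), snd (fst p), snd p))
      (fun G p => ~ R G (fst (fst p)) (snd (fst p)) (snd p))); [comp_tac|exact HN].
Qed.

Lemma Sep_enc G E : Sep G (enc E) <-> separates G E.
Proof.
assert (H : forall E, enc E = edges_code E).
{ intros E'; unfold edges_code; simpl; f_equal; apply map_ext.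
  now intros [a b]. }
split.
- intros (E' & EE & HE); rewrite <- H in EE; now rewrite (enc_inj _ _ EE).
- intros HE; exists E; split; [apply H|exact HE].
Qed.

Lemma Path_enc G w : Path G (enc w) <-> extendable G w.
Proof.
assert (H : forall w : list nat, enc w = list_code w)
  by (intros w'; simpl; now rewrite map_id).
split.
- intros (w' & Ew & Hw); rewrite <- H in Ew; now rewrite (enc_inj _ _ Ew).
- intros Hw; exists w; split; [apply H|exact Hw].
Qed.

Lemma ce_separates K {X} `{coded X} (E : X -> list (nat * nat)) :
  comp E -> ce K Sep (fun G x => separates G (E x)).
Proof.
intros HE; apply (ce_ext _ _ (fun G x => Sep G (enc (E x)))).
- intros G x _ _; apply Sep_enc.
- apply ce_decidable; now apply decidable_oracle, comp_enc.
Qed.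

Lemma ce_extendable K {X} `{coded X} (w : X -> list nat) :
  comp w -> ce K Path (fun G x => extendable G (w x)).
Proof.
intros Hw; apply (ce_ext _ _ (fun G x => Path G (enc (w x)))).
- intros G x _ _; apply Path_enc.
- apply ce_decidable; now apply decidable_oracle, comp_enc.
Qed.

(** What a simple path requires at one vertex, given the rest of the word; this local form fits
    [all_suffixes]. *)
Definition path_link (G : graph) (y : nat) (t : list nat) : Prop :=
  vert G y /\ ~ In y t /\ (t = [] \/ exists z s, t = z :: s /\ adj G y z).

Lemma simple_path_iff G w :
  simple_path G w <-> w <> [] /\ all_suffixes (path_link G) w.
Proof.
assert (H : all_suffixes (path_link G) w <->
  Forall (vert G) w /\
  (forall i, S i < length w -> adj G (nth i w 0) (nth (S i) w 0)) /\ NoDup w).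
{ induction w as [|y t IH].
  - split; [intros _|easy]; repeat split; try constructor; simpl; lia.
  - simpl all_suffixes; rewrite IH, Forall_cons_iff, NoDup_cons_iff; clear IH.
    unfold path_link; split.
    + intros [(Hy & Hyt & Hl) (Hv & Ha & Hn)]; repeat split; trivial.
      intros [|i] Hi; [|apply Ha; simpl in Hi; lia].
      destruct Hl as [->|(z & s & -> & Hz)]; [simpl in Hi; lia|exact Hz].
    + intros ([Hy Hv] & Ha & Hyt & Hn); repeat split; trivial.
      * destruct t as [|z s]; [now left|right; exists z, s].
        split; [reflexivity|]; apply (Ha 0); simpl; lia.
      * intros i Hi; apply (Ha (S i)); simpl; lia. }
rewrite H; unfold simple_path, is_path; tauto.
Qed.

(** A single bad suffix is a finite witness of failure, which makes not being a simple path
    enumerable. *)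
Lemma not_all_suffixes {Y} (P : Y -> list Y -> Prop) l :
  ~ all_suffixes P l <-> exists i y t, skipn i l = y :: t /\ ~ P y t.
Proof.
rewrite (all_suffixes_skipn P (length l)) by lia; split.
- intros HN; apply NNPP; intros HE; apply HN; intros i _.
  destruct (skipn i l) as [|y t] eqn:Ei; [now left|right].
  exists y, t; split; [reflexivity|]; apply NNPP; intros HP.
  apply HE; now exists i, y, t.
- intros (i & y & t & Ei & HP) HA; apply HP.
  destruct (HA i) as [E|(y' & t' & E & HP')].
  + assert (EL := length_skipn i l); rewrite Ei in EL; simpl in EL; lia.
  + rewrite Ei in E; discriminate.
  + rewrite Ei in E; injection E as -> ->; exact HP'.
Qed.

Lemma extendable_last_iff G w i u :
  locally_finite G -> simple_path G w -> skipn i w = [u] ->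
  extendable G w <-> infinite_set (reach (beyond G w u) u).
Proof.
intros HL Hw Ei; rewrite <- (firstn_skipn i w), Ei in Hw |- *.
now apply extendable_iff.
Qed.

Lemma skipn_last {Y} (l : list Y) : l <> [] -> exists i y, skipn i l = [y].
Proof.
destruct l as [|y l _] using rev_ind; [easy|intros _].
exists (length l), y; rewrite skipn_app, skipn_all, Nat.sub_diag; reflexivity.
Qed.

Lemma highly_computable_locally_finite G :
  highly_computable G -> locally_finite G.
Proof. intros [D HD]; apply HD. Qed.

Notation infinite_connected := (fun G => connected G /\ infinite_graph G).

(** * Enumerating extendable words and their complement from the separating sets *)

Lemma ce_path : ce infinite_connected Sep extendable.
Proof.
apply (ce_ext _ _ (fun G w =>
  (w <> [] /\ all_suffixes (path_link G) w) /\
  exists i u, skipn i w = [u] /\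
    (separation_certificate G w u \/ cofinite_certificate G w u))).
- intros G w [HG HI] HC; apply highly_computable_locally_finite in HC.
  rewrite <- simple_path_iff; split.
  + intros [Hw (i & u & Ei & Hc)].
    apply (extendable_last_iff G w i u); trivial.
    apply infinite_beyond_iff in Hc; trivial; [apply Hw|].
    apply in_skipn; now exists i, [].
  + intros He; assert (Hw := proj1 He); split; [exact Hw|].
    destruct (skipn_last w) as (i & u & Ei); [apply Hw|].
    exists i, u; split; [exact Ei|].
    apply infinite_beyond_iff; trivial; [apply Hw|apply in_skipn; now exists i, []|].
    now apply (extendable_last_iff G w i u).
- apply ce_and; [apply ce_and|].
  + ce_tac.
  + apply (ce_all_suffixes _ _ (fun w => w) (fun G _ => path_link G)); [comp_tac|].
    unfold path_link; ce_tac.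
  + unfold separation_certificate, cofinite_certificate; ce_tac;
      try (apply ce_remaining || apply ce_beyond || apply ce_separates); comp_tac.
Qed.

Lemma ce_not_path : ce infinite_connected Sep (fun G w => ~ extendable G w).
Proof.
apply (ce_ext _ _ (fun G w =>
  (w = [] \/ exists i y t, skipn i w = y :: t /\
     (~ vert G y \/ In y t \/ exists z s, t = z :: s /\ ~ adj G y z)) \/
  exists i u, skipn i w = [u] /\
    (vert G u /\ ~ infinite_set (reach (beyond G w u) u)))).
- intros G w _ HC; apply highly_computable_locally_finite in HC.
  assert (HN : (w = [] \/ exists i y t, skipn i w = y :: t /\
     (~ vert G y \/ In y t \/ exists z s, t = z :: s /\ ~ adj G y z)) <->
     ~ simple_path G w).
  { rewrite simple_path_iff.
    assert (HL : forall y t, ~ path_link G y t <->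
      (~ vert G y \/ In y t \/ exists z s, t = z :: s /\ ~ adj G y z)).
    { intros y t; unfold path_link; split.
      - intros HN; destruct (classic (vert G y)); [|tauto].
        destruct (classic (In y t)); [tauto|right; right].
        destruct t as [|z s]; [tauto|exists z, s; split; [reflexivity|]].
        intros Ha; apply HN; repeat split; trivial; right; now exists z, s.
      - intros [Hn|[Hn|(z & s & -> & Hn)]] (H1 & H2 & H3); try contradiction.
        destruct H3 as [H3|(z' & s' & E & H3)]; [discriminate|].
        injection E as <- <-; contradiction. }
    split.
    - intros [->|(i & y & t & Ei & Hy)] [H1 H2]; [easy|].
      apply HL in Hy; revert H2; apply not_all_suffixes; now exists i, y, t.
    - intros HN; destruct (classic (w = [])) as [Hw|Hw]; [now left|right].
      assert (HA : ~ all_suffixes (path_link G) w) by tauto.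
      apply not_all_suffixes in HA; destruct HA as (i & y & t & Ei & Hy).
      exists i, y, t; split; [exact Ei|now apply HL]. }
  rewrite HN; split.
  + intros [Hw|(i & u & Ei & Hu & Hf)] He; [now apply Hw, He|].
    apply Hf; now apply (extendable_last_iff G w i u HC (proj1 He) Ei).
  + intros He; destruct (classic (simple_path G w)) as [Hw|Hw]; [right|now left].
    assert (Hp := proj1 Hw); destruct Hp as (Hw0 & Hv & _).
    destruct (skipn_last w Hw0) as (i & u & Ei); exists i, u.
    split; [exact Ei|split].
    * rewrite Forall_forall in Hv; apply Hv, in_skipn; now exists i, [].
    * now rewrite <- (extendable_last_iff G w i u HC Hw Ei).
- apply ce_or; [ce_tac|].
  do 2 refine (ce_ex _ _ _ _); cbv beta; apply ce_and; [ce_tac|].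
  apply (ce_finite_class _ _
    (fun G (p : list nat * nat * nat) => beyond G (fst (fst p)) (snd p)) snd).
  + now intros G x a b [H _].
  + exact (comp_snd _ comp_id).
  + apply ce_not_beyond; comp_tac.
Qed.

Notation infinite_tree := (fun G => tree G /\ infinite_graph G).

(** * Enumerating separating sets and their complement from the extendable words *)

Lemma ce_sep : ce infinite_tree Path separates.
Proof.
apply (ce_ext _ _ (fun G E =>
  (forall e, In e E -> adj G (fst e) (snd e)) /\ edge_certificate G E)).
- intros G E [HT HI] HC; apply highly_computable_locally_finite in HC.
  split; [now intros [HE Hc]; apply edge_certificate_sound|].
  intros HS; split; [now apply separates_iff in HS|].
  apply edge_certificate_complete; trivial; apply HT.
- unfold edge_certificate, end_edge, edge_mem; ce_tac;
    try (apply ce_remaining || apply ce_extendable); comp_tac.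
Qed.

Lemma ce_not_sep : ce infinite_tree Path (fun G E => ~ separates G E).
Proof.
apply (ce_ext _ _ (fun G E =>
  (exists e, In e E /\ ~ adj G (fst e) (snd e)) \/
  exists u, vert G u /\ forall e, In e E ->
    (reach (remaining G E) u (fst e) \/
     (vert G (fst e) /\ ~ infinite_set (reach (remaining G E) (fst e)))) /\
    (reach (remaining G E) u (snd e) \/
     (vert G (snd e) /\ ~ infinite_set (reach (remaining G E) (snd e)))))).
- intros G E [[HG _] HI] _.
  destruct (classic (forall e, In e E -> adj G (fst e) (snd e))) as [HE|HE].
  + rewrite not_separates_iff by trivial; split.
    * intros [(e & He & Hn)|(u & Hu & Hc)]; [exfalso; auto|].
      exists u; split; [exact Hu|]; intros e He; specialize (Hc e He); tauto.
    * intros (u & Hu & Hc); right; exists u; split; [exact Hu|].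
      intros e He; specialize (Hc e He); specialize (HE e He).
      (* The conjuncts [vert] were added to fit [ce_finite_class]; they hold because endpoints of
         edges are vertices. *)
      assert (H1 := adj_vert G _ _ HE).
      assert (H2 := adj_vert G _ _ (adj_sym G _ _ HE)); tauto.
  + split.
    * intros _ HS; apply HE; now apply separates_iff in HS.
    * intros _; left; apply NNPP; intros HN; apply HE; intros e He.
      apply NNPP; intros Hn; apply HN; now exists e.
- assert (HF : forall f : nat * nat -> nat, comp f ->
    ce infinite_tree Path (fun G (p : list (nat * nat) * nat * (nat * nat)) =>
      vert G (f (snd p)) /\
      ~ infinite_set (reach (remaining G (fst (fst p))) (f (snd p))))).
  { intros f Hf.
    apply (ce_finite_class _ _
      (fun G (p : list (nat * nat) * nat * (nat * nat)) =>
         remaining G (fst (fst p))) (fun p => f (snd p))).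
    - now intros G x a b [H _].
    - apply (comp_comp f (fun p => snd p) Hf); comp_tac.
    - apply ce_not_remaining; comp_tac. }
  apply ce_or; [ce_tac|].
  refine (ce_ex _ _ _ _); cbv beta; apply ce_and; [ce_tac|].
  refine (ce_forall_in _ _ _ _ _ _); [comp_tac|]; cbv beta.
  apply ce_and; apply ce_or.
  + ce_tac; apply ce_remaining; comp_tac.
  + exact (HF fst (comp_fst _ comp_id)).
  + ce_tac; apply ce_remaining; comp_tac.
  + exact (HF snd (comp_snd _ comp_id)).
Qed.

Lemma uniform_turing_le_ext K A A' B :
  (forall G n, A G n <-> A' G n) ->
  uniform_turing_le K A B -> uniform_turing_le K A' B.
Proof.
intros HA (f & Hf & Ef); exists f; split; [exact Hf|].
intros G D HG HD; destruct (Ef G D HG HD) as (r & Er & Hr).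
exists r; split; [exact Er|]; intros n; rewrite <- HA; apply Hr.
Qed.

Lemma uniform_turing_le_turing_le K A B G :
  uniform_turing_le K A B -> K G -> highly_computable G -> turing_le (A G) (B G).
Proof.
intros (f & _ & Ef) HG [D HD]; destruct (Ef G D HG HD) as (r & _ & Hr).
now exists r.
Qed.

Theorem theorem3p8 :
  (forall G : graph,
     highly_computable G -> connected G -> infinite_graph G ->
     turing_le (Path G) (Sep G) /\
     (tree G -> turing_equiv (Sep G) (Path G))) /\
  uniform_turing_le (fun G => connected G /\ infinite_graph G) Path Sep /\
  uniform_turing_le (fun G => tree G /\ infinite_graph G) Sep Path.
Proof.
assert (HP : uniform_turing_le infinite_connected Path Sep).
{ eapply uniform_turing_le_ext; [|exact (uniform_reduction _ _ _ ce_path ce_not_path)].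
  (* Every number codes a word, so the result on words covers all numbers. *)
  intros G n; cbv beta; now rewrite <- Path_enc, enc_den. }
assert (HS : uniform_turing_le infinite_tree Sep Path).
{ eapply uniform_turing_le_ext; [|exact (uniform_reduction _ _ _ ce_sep ce_not_sep)].
  intros G n; cbv beta; now rewrite <- Sep_enc, enc_den. }
split; [|now split].
intros G HC HG HI.
assert (HPG := uniform_turing_le_turing_le _ _ _ G HP (conj HG HI) HC).
split; [exact HPG|]; intros HT; split; [|exact HPG].
exact (uniform_turing_le_turing_le _ _ _ G HS (conj HT HI) HC).
Qed.
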